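(* Let $\mathfrak{h}$ be a separable Hilbert space and let $\mathfrak{X}=\mathscr{T}_s(\mathfrak{h})$ be the real Banach space of self-adjoint trace class operators on $\mathfrak{h}$ with the trace norm. Let $(\mathcal{U}(t))_{t\ge0}$ be a substochastic $C_0$-semigroup on $\mathfrak{X}$ with generator $\mathcal{A}$, $\mathcal{B}:\mathscr{D}(\mathcal{A})\to\mathfrak{X}$ a positive linear operator with $\mathrm{Trace}[(\mathcal{A}+\mathcal{B})\varrho]\le0$ for all $\varrho\in\mathscr{D}(\mathcal{A})\cap\mathfrak{X}_+$, let $(\mathcal{V}(t))_{t\ge0}$ be the associated minimal semigroup with generator $\mathcal{G}$, and let $\mathcal{H}=\{\varrho\in\mathfrak{X}_+:\langle\mathbf{\Xi}_\lambda,\varrho\rangle=0\text{ for any }\lambda>0\}$. Let $\mathbf{P}$ be the orthogonal projection of $\mathfrak{h}$ onto $\mathrm{Null}(\beta_\lambda)$, where $\beta_\lambda$ is the positive bounded self-adjoint operator on $\mathfrak{h}$ with $\langle\mathbf{\Xi}_\lambda,\varrho\rangle=\mathrm{Trace}[\beta_\lambda\varrho]$ for all $\varrho\in\mathfrak{X}_+$ (this null space does not depend on $\lambda>0$). Then $$\mathscr{H}:=\mathcal{H}-\mathcal{H}=\{\varrho\in\mathfrak{X}:\varrho=\mathbf{P}\varrho=\varrho\mathbf{P}\}.$$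
   Context: $\mathfrak{X}=\mathscr{T}_s(\mathfrak{h})$ is ordered by the cone $\mathfrak{X}_+$ of positive semidefinite operators, $\|\varrho\|=\mathrm{Trace}[|\varrho|]$, and $\langle\mathbf{\Psi},\varrho\rangle=\mathrm{Trace}[\varrho]$, so that $\langle\mathbf{\Psi},\varrho\rangle=\|\varrho\|$ on $\mathfrak{X}_+$. A linear operator on $\mathfrak{X}$ is positive if it maps positive elements of its domain into $\mathfrak{X}_+$. A $C_0$-semigroup $(T(t))_{t\ge0}$ on $\mathfrak{X}$ is substochastic if each $T(t)$ is positive and $\|T(t)u\|\le\|u\|$ for $u\in\mathfrak{X}_+$. Minimal semigroup: under the stated hypotheses there is a smallest (for the operator order, for each $t$) substochastic $C_0$-semigroup $(\mathcal{V}(t))_{t\ge0}$ whose generator $\mathcal{G}$ extends $(\mathcal{A}+\mathcal{B},\mathscr{D}(\mathcal{A}))$; it satisfies $(\lambda-\mathcal{G})^{-1}u=\lim_{n\to\infty}(\lambda-\mathcal{A})^{-1}\sum_{k=0}^n[\mathcal{B}(\lambda-\mathcal{A})^{-1}]^ku$ for all $\lambda>0$, $u\in\mathfrak{X}$. Functionals: $\mathfrak{a}_0(u)=-\langle\mathbf{\Psi},\mathcal{G}u\rangle$ for $u\in\mathscr{D}(\mathcal{G})$; $\mathfrak{a}$ is its restriction to $\mathscr{D}(\mathcal{A})$; and $\overline{\mathfrak{a}}:\mathscr{D}(\mathcal{G})\to\mathbb{R}$ is the linear functional defined by $\overline{\mathfrak{a}}((\lambda-\mathcal{G})^{-1}u)=\sum_{n=0}^\infty\mathfrak{a}\big((\lambda-\mathcal{A})^{-1}[\mathcal{B}(\lambda-\mathcal{A})^{-1}]^nu\big)$,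 $u\in\mathfrak{X}$, where the series converges and the resulting functional does not depend on $\lambda>0$. For $\lambda>0$, $\mathbf{\Xi}_\lambda\in\mathfrak{X}^\star$ is the (positive) functional $\langle\mathbf{\Xi}_\lambda,u\rangle=\mathfrak{a}_0((\lambda-\mathcal{G})^{-1}u)-\overline{\mathfrak{a}}((\lambda-\mathcal{G})^{-1}u)$, $u\in\mathfrak{X}$. *)

(* Defs.v *)
From HB Require Import structures.
From mathcomp Require Import all_boot all_order all_algebra.
From mathcomp Require Import all_classical all_reals all_analysis.
From mathcomp Require Import complex.
From mathcomp.analysis.showcase Require summability.

Set Implicit Arguments.
Unset Strict Implicit.
Unset Printing Implicit Defensive.

Import Order.TTheory GRing.Theory Num.Theory numFieldNormedType.Exports.
Local Open Scope classical_set_scope.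
Local Open Scope ring_scope.

(** * Operators on a Hilbert space

    A complex Hilbert space is a [h : completeNormedModType R[i]] with an inner
    product [ip : {dot h for Num.Def.conjC}] (linear in its first argument)
    inducing the norm; this norm takes its values in [R[i]]. *)

Definition hilbert_ip (R : realType) (h : completeNormedModType R[i])
    (ip : {dot h for Num.Def.conjC}) : Prop :=
  forall x : h, `|x| ^+ 2 = ip x x.

Definition separable (T : topologicalType) : Prop :=
  exists D : set T, countable D /\ dense D.

Section HilbertOperators.
Variables (R : realType) (h : completeNormedModType R[i]).
Variable ip : {dot h for Num.Def.conjC}.
Implicit Types (T S P : h -> h) (E N : set h).

Definition bounded_op T : Prop := linear T /\ continuous T.

Definition selfadjoint T : Prop := forall x y, ip (T x) y = ip x (T y).

(* In [R[i]], [0 <= z] says that [z] is real and nonnegative. *)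
Definition psd T : Prop := forall x, 0 <= ip (T x) x.

Definition adjoint T : h -> h :=
  xget (fun=> 0)
    [set S | bounded_op S /\ forall x y, ip (T x) y = ip x (S y)].

(* |T|, the positive square root of T^* T *)
Definition absop T : h -> h :=
  xget (fun=> 0) [set S | [/\ bounded_op S, selfadjoint S, psd S
                            & S \o S = adjoint T \o T]].

Definition orthonormal_basis E : Prop :=
  (forall e f, E e -> E f -> ip e f = (e == f)%:R) /\
  (forall x, (forall e, E e -> ip x e = 0) -> x = 0).

(* A basis chosen once and for all: traces do not depend on it. *)
Definition basis_of_space : set h := xget set0 orthonormal_basis.

(* Unordered sum (limit along the finite subsets of the basis) of the diagonal
   coefficients; it is meaningful for trace class operators only. *)
Definition trace T : R[i] :=
  summability.sum
    ((fun e => ip (T e) e : R[i]^o) \_ basis_of_space).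

Definition trace_class T : Prop :=
  bounded_op T /\
  (\esum_(e in basis_of_space) (complex.Re (ip (absop T e) e))%:E < +oo)%E.

Definition null_space T : set h := [set x | T x = 0].

Definition orthogonal_projection P N : Prop :=
  [/\ bounded_op P, P \o P = P, selfadjoint P & range P = N].

End HilbertOperators.

(** [X], seen through [op], is the real Banach space of self-adjoint trace class
    operators on [h] with the norm Trace |T|. Injectivity of [op] follows from
    [selfadjoint_trace_norm]. *)
Record is_selfadjoint_trace_class_space (R : realType)
    (h : completeNormedModType R[i]) (ip : {dot h for Num.Def.conjC})
    (X : completeNormedModType R) (op : X -> h -> h) : Prop := {
  selfadjoint_trace_linear : forall (a : R) (u v : X) (x : h),
    op (a *: u + v) x = a%:C%C *: op u x + op v x;
  selfadjoint_trace_range :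
    range op = [set T | selfadjoint ip T /\ trace_class ip T];
  selfadjoint_trace_norm : forall u : X,
    (`|u|)%:C%C = trace ip (absop ip (op u)) }.

Section TraceClassSpace.
Variables (R : realType) (h : completeNormedModType R[i]).
Variable ip : {dot h for Num.Def.conjC}.
Variables (X : completeNormedModType R) (op : X -> h -> h).

Definition positive_cone : set X := [set u | psd ip (op u)].

(* [trace] is [R[i]]-valued, but real on self-adjoint operators. *)
Definition Psi (u : X) : R := complex.Re (trace ip (op u)).

End TraceClassSpace.

(** * Substochastic semigroups on a Banach space [X] with positive cone [K] *)

(* The values of [opfun] outside [opdom] are irrelevant. *)
Record partial_op (X : Type) := PartialOp { opdom : set X; opfun :> X -> X }.

Section Semigroups.
Variables (R : realType) (X : completeNormedModType R) (K : set X).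
Implicit Types (T V W : R -> X -> X) (A G : partial_op X) (B : X -> X).

Definition linear_on (Y : lmodType R) (D : set X) (f : X -> Y) : Prop :=
  forall (a : R) (u v : X), D u -> D v -> f (a *: u + v) = a *: f u + f v.

Definition C0_semigroup T : Prop :=
  [/\ forall t : R, 0 <= t -> linear (T t) /\ continuous (T t),
      forall u, T 0 u = u,
      forall (s t : R) u, 0 <= s -> 0 <= t -> T (s + t) u = T s (T t u)
    & forall u, T t u @[t --> 0^'+] --> u].

Definition generator T : partial_op X :=
  PartialOp
    [set u | cvg (t^-1 *: (T t u - u) @[t --> 0^'+])]
    (fun u => lim (t^-1 *: (T t u - u) @[t --> 0^'+])).

Definition positive_op (D : set X) B : Prop := forall u, D u -> K u -> K (B u).

Definition substochastic T : Prop :=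
  C0_semigroup T /\
  forall t : R, 0 <= t ->
    positive_op setT (T t) /\ forall u, K u -> `|T t u| <= `|u|.

Definition extends_sum G A B : Prop :=
  forall u, opdom A u -> opdom G u /\ G u = A u + B u.

Definition minimal_semigroup A B V : Prop :=
  [/\ substochastic V, extends_sum (generator V) A B
    & forall W, substochastic W -> extends_sum (generator W) A B ->
        forall (t : R) u, 0 <= t -> K u -> K (W t u - V t u)].

(* (lambda - A)^{-1} *)
Definition resolvent A (lambda : R) (u : X) : X :=
  xget 0 [set w | opdom A w /\ lambda *: w - A w = u].

Variable psi : X -> R.

(* On [opdom G] this is the functional a_0; its restriction to the domain of the
   unperturbed generator is the functional a. *)
Definition a0 G (u : X) : R := - psi (G u).

Definition is_abar A B G (abar : X -> R) : Prop :=
  linear_on (Y := R^o) (opdom G) abar /\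
  forall (lambda : R) u, 0 < lambda ->
    series (fun n => a0 G (resolvent A lambda
                             (iter n (B \o resolvent A lambda) u))) @ \oo
      --> abar (resolvent G lambda u).

Definition Xi G (abar : X -> R) (lambda : R) (u : X) : R :=
  a0 G (resolvent G lambda u) - abar (resolvent G lambda u).

Definition Xi_null_cone G (abar : X -> R) : set X :=
  [set u | K u /\ forall lambda : R, 0 < lambda -> Xi G abar lambda u = 0].

End Semigroups.

(* Main.v *)
Require Import Defs.
From HB Require Import structures.
From mathcomp Require Import all_boot all_order all_algebra.
From mathcomp Require Import all_classical all_reals all_analysis.
From mathcomp Require Import complex.
From mathcomp Require Import finmap ring lra.
From mathcomp.analysis.showcase Require Import summability.

Set Implicit Arguments.
Unset Strict Implicit.
Unset Printing Implicit Defensive.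

Import Order.TTheory GRing.Theory Num.Theory numFieldNormedType.Exports.
Local Open Scope classical_set_scope.
Local Open Scope ring_scope.

(** The functional [Xi l], [l > 0], is positive and dominated by the trace: the
    partial sums [r_0 + ... + r_{n-1}], [r_k = (l-A)^{-1} (B (l-A)^{-1})^k u],
    solve [(l-G) r = u - v_n] with [v_n = (B (l-A)^{-1})^n u >= 0], so that
    [Xi l u] is the limit of [a_0 ((l-G)^{-1} v_n) >= 0]. The resolvent identity
    gives [Xi l u = Xi m u + (m-l) Xi m ((l-G)^{-1} u)]; by positivity the null
    cone of [Xi l] is contained in that of [Xi m] for [m >= l] and is invariant
    under [(l-G)^{-1}], and a Neumann expansion extends the inclusion to
    [m < l]. Hence the null cones of all [Xi l] agree.

    If [u >= 0] and [Xi l u = 0] then [Xi l] vanishes on the rank one operator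
    [(u x)(u x)^*], which is dominated by a multiple of [u]; its value there is
    [<beta (u x), u x>], so [beta u = 0], i.e. [P u = u = u P]. Conversely
    [beta u = 0] trivially gives [Xi l u = 0], and a self-adjoint [u = P u P]
    is the difference of [(|u| + u) / 2] and [(|u| - u) / 2], which vanish
    wherever [u] does.

    Positivity of [|u| + u] and [|u| - u], and uniqueness of the positive square
    root, come from the implication [u^2 <= w^2 => u <= w] for [w >= 0].
    Resolvents of a contraction semigroup [T] are limits, as [h] tends to [0],
    of the Riemann sums [h (sum_k e^{-l k h} T(k h))], obtained as fixed points
    of contractions. *)

(** * Operators on a Hilbert space *)

#[local] Existing Instance totally_filter.

Section RealInnerProduct.
Variables (R : realType) (h : completeNormedModType R[i]).
Variable ip : {dot h for Num.Def.conjC}.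
Implicit Types (x y z : h) (a : R) (T S : h -> h).

Local Notation Re := complex.Re.

Definition rip x y : R := Re (ip x y).

Definition linear_op_of T (T_lin : linear T) : {linear h -> h} :=
  HB.pack T (GRing.isLinear.Build _ _ _ _ T T_lin).

Lemma ReD (c d : R[i]) : Re (c + d) = Re c + Re d.
Proof. by case: c => a b; case: d. Qed.

Lemma ReN (c : R[i]) : Re (- c) = - Re c.
Proof. by case: c. Qed.

Lemma ReZ a (c : R[i]) : Re (a%:C%C * c) = a * Re c.
Proof. by case: c => x y /=; rewrite mul0r subr0. Qed.

Lemma Re_conjc (c : R[i]) : Re (conjc c) = Re c.
Proof. by case: c. Qed.

Lemma conjCc (c : R[i]) : c^* = conjc c.
Proof.
have [->|c0] := eqVneq c 0; first by rewrite conjC0 conjc0.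
by apply: (mulfI c0); rewrite -normCK sqr_normc.
Qed.

Lemma ipC x y : ip x y = conjc (ip y x).
Proof. by rewrite -conjCc (hermitian_subproof x y) expr0 mul1r. Qed.

Lemma ipDl x y z : ip (x + y) z = ip x z + ip y z.
Proof. exact: linearDl. Qed.

Lemma ipDr x y z : ip x (y + z) = ip x y + ip x z.
Proof. exact: linearDr. Qed.

Lemma ipZl (c : R[i]) x y : ip (c *: x) y = c * ip x y.
Proof. exact: linearZl_LR. Qed.

Lemma ipZr (c : R[i]) x y : ip x (c *: y) = conjc c * ip x y.
Proof. by rewrite ipC ipZl rmorphM (ipC x y). Qed.

Lemma ip0l y : ip 0 y = 0.
Proof. by rewrite -(scale0r (0 : h)) ipZl mul0r. Qed.

Lemma ip0r x : ip x 0 = 0.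
Proof. by rewrite ipC ip0l conjc0. Qed.

Lemma ipNl x y : ip (- x) y = - ip x y.
Proof. exact: linearNl. Qed.

Lemma ripC x y : rip x y = rip y x.
Proof.
by rewrite /rip ipC Re_conjc.
Qed.

Lemma ripDl x y z : rip (x + y) z = rip x z + rip y z.
Proof. by rewrite /rip ipDl ReD. Qed.

Lemma ripNl x y : rip (- x) y = - rip x y.
Proof. by rewrite /rip ipNl ReN. Qed.

Lemma rip0l y : rip 0 y = 0.
Proof. by rewrite -{1}(subrr y) ripDl ripNl subrr. Qed.

Lemma ripZl a x y : rip (a%:C%C *: x) y = a * rip x y.
Proof. by rewrite /rip ipZl ReZ. Qed.

Lemma ripDr x y z : rip x (y + z) = rip x y + rip x z.
Proof. by rewrite ripC ripDl !(ripC x). Qed.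

Lemma ripNr x y : rip x (- y) = - rip x y.
Proof. by rewrite ripC ripNl ripC. Qed.

Lemma ripZr a x y : rip x (a%:C%C *: y) = a * rip x y.
Proof. by rewrite ripC ripZl ripC. Qed.

Lemma rip_ge0 x : 0 <= rip x x.
Proof. by have := dnorm_ge0 ip x; rewrite lecE => /andP[]. Qed.

Lemma ip_rip x : ip x x = (rip x x)%:C%C.
Proof.
by have /ger0_Im := dnorm_ge0 ip x; rewrite /rip; case: (ip x x) => a b /= ->.
Qed.

Lemma rip_eq0 x : rip x x = 0 -> x = 0.
Proof. by move=> x0; apply/eqP; rewrite -(dnorm_eq0 ip) ip_rip x0. Qed.

(** For [C <> 0] the quadratic is tested at its vertex [- B / C]. For [C = 0] it is affine in [a],
    which forces [B = 0]. *)
Lemma quadratic_ge0 (A B C : R) : 0 <= C ->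
  (forall a, 0 <= A + 2 * a * B + a ^+ 2 * C) -> B ^+ 2 <= A * C.
Proof.
move=> C_ge0 H; have [C0|C0] := eqVneq C 0.
- have [->|B0] := eqVneq B 0; first by rewrite C0; lra.
  (* The point where the affine function takes the value [-1]. *)
  have := H (- (A + 1) / (2 * B)).
  have -> : A + 2 * (- (A + 1) / (2 * B)) * B + (- (A + 1) / (2 * B)) ^+ 2 * C
            = -1 by rewrite C0; field.
  lra.
- have := H (- B / C).
  have -> : A + 2 * (- B / C) * B + (- B / C) ^+ 2 * C = (A * C - B ^+ 2) / C.
    by field.
  by rewrite pmulr_lge0 ?subr_ge0// invr_gt0 lt_def C0.
Qed.

Lemma selfadjoint_rip T x y : selfadjoint ip T -> rip (T x) y = rip x (T y).
Proof. by move=> T_sa; rewrite /rip T_sa. Qed.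

(** Self-adjointness makes [ip (T x) x] equal to its conjugate, so the reality contained in [0 <= z]
    over [R[i]] is automatic. *)
Lemma psd_rip T : selfadjoint ip T ->
  psd ip T <-> forall x, 0 <= rip (T x) x.
Proof.
move=> T_sa; split=> T_psd x; have := T_psd x; rewrite lecE; first by case/andP.
move=> /= ->; rewrite andbT.
have : ip (T x) x = conjc (ip (T x) x).
  by rewrite {1}T_sa ipC.
case: (ip (T x) x) => a b [] /= /eqP; rewrite -subr_eq0 opprK -mulr2n mulrn_eq0.
by [].
Qed.

Lemma psd_cauchy_schwarz T x y : linear T -> selfadjoint ip T -> psd ip T ->
  rip (T x) y ^+ 2 <= rip (T x) x * rip (T y) y.
Proof.
move=> T_lin T_sa /(psd_rip T_sa) T_psd.
apply: quadratic_ge0 => [//|a]; have := T_psd (a%:C%C *: y + x).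
rewrite T_lin !(ripDl, ripDr, ripZl, ripZr).
rewrite (selfadjoint_rip y x T_sa) (ripC y (T x)); lra.
Qed.

Lemma cauchy_schwarz x y : rip x y ^+ 2 <= rip x x * rip y y.
Proof.
by have := @psd_cauchy_schwarz idfun x y; apply=> // z; exact: dnorm_ge0.
Qed.

Hypothesis h_hilbert : hilbert_ip ip.

Lemma norm_rip x : `|x| = (Num.sqrt (rip x x))%:C%C.
Proof.
apply/eqP; rewrite -(@eqrXn2 _ 2)// ?ler0c ?sqrtr_ge0//.
by rewrite h_hilbert ip_rip -rmorphXn sqr_sqrtr ?rip_ge0.
Qed.

Lemma bounded_rip T : bounded_op T ->
  exists2 M, 0 < M & forall x, rip (T x) (T x) <= M * rip x x.
Proof.
move=> [T_lin T_cont].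
have /linear_boundedP/pinfty_ex_gt0[r r_gt0 rP] :=
  @continuous_linear_bounded _ _ _ 0 (linear_op_of T_lin) (T_cont 0).
have := ltW r_gt0; rewrite lecE => /andP[/eqP/= Im0 _].
have rE : r = (Re r)%:C%C by case: (r) Im0 => a b /= ->.
rewrite rE ltcR in r_gt0.
exists (Re r ^+ 2); first by rewrite exprn_gt0.
move=> x; rewrite -[X in _ <= X]/(Re (Re r ^+ 2 * rip x x)%:C%C).
have := rP x; rewrite rE !norm_rip -rmorphM lecR => le1.
rewrite -(sqr_sqrtr (rip_ge0 x)) -(sqr_sqrtr (rip_ge0 (T x))) -exprMn.
by rewrite lerXn2r// ?nnegrE ?sqrtr_ge0// mulr_ge0 ?sqrtr_ge0 ?ltW.
Qed.

Lemma rip_bounded T M : linear T ->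
  (forall x, rip (T x) (T x) <= M * rip x x) -> bounded_op T.
Proof.
move=> T_lin TM; split=> //.
pose f := linear_op_of T_lin; suff: continuous f by [].
apply/bounded_linear_continuous/linear_boundedP.
near=> r => x; rewrite !norm_rip.
apply: (@le_trans _ _ ((Num.sqrt `|M|)%:C%C * (Num.sqrt (rip x x))%:C%C)).
  rewrite -rmorphM lecR -sqrtrM// ler_wsqrtr// (le_trans (TM x))//.
  by rewrite ler_wpM2r ?rip_ge0// ler_norm.
rewrite ler_wpM2r ?ler0c ?sqrtr_ge0//.
by near: r; apply: nbhs_pinfty_ge; rewrite realE ler0c sqrtr_ge0.
Unshelve. all: by end_near. Qed.

Lemma bounded_opD T S : bounded_op T -> bounded_op S ->
  bounded_op (fun x => T x + S x).
Proof.
move=> [T_lin T_cont] [S_lin S_cont]; split=> [c x y|x].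
  by rewrite T_lin S_lin scalerDr addrACA.
by apply: cvgD; [exact: T_cont|exact: S_cont].
Qed.

Lemma bounded_opZ (c : R[i]) T : bounded_op T -> bounded_op (fun x => c *: T x).
Proof.
move=> [T_lin T_cont]; split=> [d x y|x].
  by rewrite T_lin scalerDr !scalerA mulrC.
by apply: cvgZr; exact: T_cont.
Qed.

Lemma bounded_id : bounded_op (@idfun h).
Proof. by split=> // x; exact: cvg_id. Qed.

Lemma selfadjointD T S : selfadjoint ip T -> selfadjoint ip S ->
  selfadjoint ip (fun x => T x + S x).
Proof.
by move=> T_sa S_sa x y; rewrite ipDl ipDr T_sa S_sa.
Qed.

Lemma selfadjointZ a T : selfadjoint ip T ->
  selfadjoint ip (fun x => a%:C%C *: T x).
Proof.
by move=> T_sa x y; rewrite ipZl ipZr T_sa conjc_real.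
Qed.

(** Cauchy-Schwarz for the form of [T] at [x] and [T x] gives [|T x|^4 <= <T x, x> <T (T x), T x>],
    and the last factor is at most [sqrt M |T x|^2]; hence [C = sqrt M]. *)
Lemma psd_sqr_bound T : bounded_op T -> selfadjoint ip T -> psd ip T ->
  exists2 C, 0 < C & forall x, rip (T x) (T x) <= C * rip (T x) x.
Proof.
move=> T_bd T_sa T_psd; have [M M0 TM] := bounded_rip T_bd.
have /(psd_rip T_sa) T_ge0 := T_psd.
exists (Num.sqrt M) => [|x]; first by rewrite sqrtr_gt0.
have [N0|N0] := eqVneq (rip (T x) (T x)) 0.
  by rewrite N0 mulr_ge0 ?sqrtr_ge0.
have N_gt0 : 0 < rip (T x) (T x) by rewrite lt_def N0 rip_ge0.
have cs1 := psd_cauchy_schwarz x (T x) (proj1 T_bd) T_sa T_psd.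
have cs2 : rip (T (T x)) (T x) <= Num.sqrt M * rip (T x) (T x).
  rewrite -(@ler_pXn2r _ 2) ?nnegrE ?mulr_ge0 ?sqrtr_ge0 ?rip_ge0//.
  rewrite exprMn (sqr_sqrtr (ltW M0)) (le_trans (cauchy_schwarz _ _))//.
  by rewrite expr2 mulrA ler_wpM2r// rip_ge0.
rewrite -(ler_pM2r N_gt0) -expr2 (le_trans cs1)// mulrC mulrAC.
by rewrite ler_wpM2r.
Qed.

(* If [m < 0] were the bottom of the spectrum of [w - u] and [x] an approximate
   eigenvector, then [u x = w x - m x] approximately, so that
   [|u x|^2 >= |w x|^2 + m^2 |x|^2] approximately. *)
Lemma psd_sub u w : bounded_op u -> selfadjoint ip u ->
  bounded_op w -> selfadjoint ip w -> psd ip w ->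
  (forall x, rip (u x) (u x) <= rip (w x) (w x)) ->
  forall x, rip (u x) x <= rip (w x) x.
Proof.
move=> u_bd u_sa w_bd w_sa /(psd_rip w_sa) w_psd uw x0.
rewrite leNgt; apply/negP => qx0.
pose d x := w x + (-1)%:C%C *: u x.
have d_bd : bounded_op d by apply: bounded_opD => //; exact: bounded_opZ.
have d_sa : selfadjoint ip d by apply: selfadjointD => //; exact: selfadjointZ.
have dE x y : rip (d x) y = rip (w x) y - rip (u x) y.
  by rewrite ripDl ripZl mulN1r.
have x0_neq0 : x0 != 0.
  apply: contraTneq qx0 => ->.
  by rewrite !(ripC _ 0) !rip0l ltxx.
have sq_gt0 x : x != 0 -> 0 < rip x x.
  move=> x_neq0; rewrite lt_def rip_ge0 andbT.
  by apply: contra_neq x_neq0 => /rip_eq0.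
have [M M0 dM] := bounded_rip d_bd.
(* The Rayleigh quotients of [d = w - u]; their infimum [m] is negative because of [x0]. *)
pose Q := [set rip (d x) x / rip x x | x in [set x | x != 0]].
have Q_lb : has_lbound Q.
  exists (- (M + 1)) => _ [x /= x_neq0 <-].
  rewrite ler_pdivlMr ?sq_gt0//.
  have := cauchy_schwarz (d x) x; have := dM x; have := sq_gt0 _ x_neq0.
  move: (rip x x) (rip (d x) x) (rip (d x) (d x)) => a b c a0 ca bca.
  have bM : b ^+ 2 <= M * a ^+ 2.
    by rewrite (le_trans bca)// [a ^+ 2]expr2 mulrA ler_pM2r.
  rewrite leNgt; apply/negP => ab.
  have : ((M + 1) * a) ^+ 2 < b ^+ 2.
    have Ma : 0 < (M + 1) * a by rewrite mulr_gt0 ?addr_gt0.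
    rewrite -[b ^+ 2]sqrrN ltr_pXn2r ?nnegrE//; lra.
  have : 0 < a ^+ 2 by rewrite exprn_gt0.
  by rewrite exprMn; nra.
have Q_inf : has_inf Q by split=> //; exists (rip (d x0) x0 / rip x0 x0), x0.
pose m := inf Q.
have m_lt0 : m < 0.
  apply: (@le_lt_trans _ _ (rip (d x0) x0 / rip x0 x0)).
    by apply: ge_inf => //; exists x0.
  by rewrite pmulr_llt0 ?invr_gt0 ?sq_gt0// dE subr_lt0.
have mP x : m * rip x x <= rip (d x) x.
  have [->|x_neq0] := eqVneq x 0.
    by rewrite [in leRHS]ripC !rip0l mulr0.
  by rewrite -ler_pdivlMr ?sq_gt0//; apply: ge_inf => //; exists x.
(* [z = d - m] is positive, so [psd_sqr_bound] makes [z x] small relative to [x] once the quotient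
   at [x] is close to [m]. *)
pose z x := d x + (- m)%:C%C *: x.
have z_bd : bounded_op z.
  by apply: bounded_opD => //; apply: bounded_opZ; exact: bounded_id.
have z_sa : selfadjoint ip z.
  by apply: selfadjointD => //; apply: (@selfadjointZ _ idfun).
have zE x : rip (z x) x = rip (d x) x - m * rip x x.
  by rewrite ripDl ripZl mulNr.
have z_psd : psd ip z by apply/psd_rip => // x; rewrite zE subr_ge0.
have [C C0 zC] := psd_sqr_bound z_bd z_sa z_psd.
have [N N0 uN] := bounded_rip u_bd.
have m2_gt0 : 0 < m ^+ 2 by rewrite exprn_even_gt0//= lt_eqF.
(* [e] and [delta] make [e N] and [(1 + 1/e) C delta] both equal to [m^2 / 4], so that the two error
   terms use up only half of [m^2 |x|^2]. *)
pose e := m ^+ 2 / (4 * N).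
have e_gt0 : 0 < e by rewrite divr_gt0// mulr_gt0.
pose delta := m ^+ 2 / (4 * C * (1 + e^-1)).
have ie_gt0 : 0 < e^-1 by rewrite invr_gt0.
have delta_gt0 : 0 < delta.
  by rewrite divr_gt0// mulr_gt0 ?addr_gt0// mulr_gt0.
have [_ [x x_neq0 <-] xdelta] : exists2 q, Q q & q < m + delta.
  exact: inf_adherent.
have a0 := sq_gt0 _ x_neq0.
rewrite ltr_pdivrMr// in xdelta.
have zx : rip (z x) (z x) <= C * (delta * rip x x).
  by rewrite (le_trans (zC x))// ler_wpM2l ?ltW// zE; lra.
(* Expand the squares of both sides of [u x + z x = w x - m x]: the cross term [- 2 m <w x, x>] is
   nonnegative because [m < 0], and [|u x| <= |w x|]. *)
have key : m ^+ 2 * rip x x <= 2 * rip (u x) (z x) + rip (z x) (z x).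
  have uzE : u x + z x = w x + (- m)%:C%C *: x.
    by rewrite /z /d rmorphN1 scaleN1r addrA (addrC (w x)) addNKr.
  move: (z x) uzE => y uzE.
  have : rip (u x + y) (u x + y) =
         rip (w x + (- m)%:C%C *: x) (w x + (- m)%:C%C *: x) by rewrite uzE.
  rewrite !(ripDl, ripDr, ripZl, ripZr) (ripC y (u x)) (ripC x (w x)).
  have := uw x; have := w_psd x; nra.
have young :
    2 * rip (u x) (z x) <= e * rip (u x) (u x) + e^-1 * rip (z x) (z x).
  move: (z x) => y; have := rip_ge0 (e%:C%C *: u x - y).
  rewrite !(ripDl, ripDr, ripZl, ripZr, ripNl, ripNr) (ripC y (u x)) => pos.
  rewrite -(ler_pM2l e_gt0) [leRHS]mulrDr (mulrA e e^-1) divff ?gt_eqF// mul1r.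
  lra.
have uNx := uN x.
have h1 : e * rip (u x) (u x) <= m ^+ 2 / 4 * rip x x.
  have -> : m ^+ 2 / 4 * rip x x = e * (N * rip x x) by rewrite /e; field; lra.
  by rewrite ler_wpM2l// ltW.
have h2 : (1 + e^-1) * rip (z x) (z x) <= m ^+ 2 / 4 * rip x x.
  have -> : m ^+ 2 / 4 * rip x x = (1 + e^-1) * (C * (delta * rip x x)).
    by rewrite /delta; field; rewrite !gt_eqF ?addr_gt0.
  by rewrite ler_wpM2l// ltW// addr_gt0.
have m2 : 0 < m ^+ 2 * rip x x by rewrite mulr_gt0.
lra.
Qed.

Definition sqnormc (c : R[i]) : R := Re c ^+ 2 + complex.Im c ^+ 2.

Lemma sqnormcE (c : R[i]) : c * conjc c = (sqnormc c)%:C%C.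
Proof.
by case: c => a b; rewrite /sqnormc; apply/eqP; rewrite eq_complex /=;
  apply/andP; split; apply/eqP; ring.
Qed.

Lemma sqnormc_ge0 (c : R[i]) : 0 <= sqnormc c.
Proof. by rewrite addr_ge0 ?sqr_ge0. Qed.

Lemma sqnormc_norm (c : R[i]) : `|c| ^+ 2 = (sqnormc c)%:C%C.
Proof. by rewrite sqr_normc sqnormcE. Qed.

Lemma ripZZ (c : R[i]) x : rip (c *: x) (c *: x) = sqnormc c * rip x x.
Proof. by rewrite /rip ipZl ipZr mulrA sqnormcE ReZ. Qed.

(** With [c = <T x, y>], replacing [x] by [conjc c *: x] turns the value of the form into the real
    number [|c|^2]; the real inequality then carries a common factor [|c|^2]. *)
Lemma complex_psd_cauchy_schwarz T x y :
  linear T -> selfadjoint ip T -> psd ip T ->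
  sqnormc (ip (T x) y) <= rip (T x) x * rip (T y) y.
Proof.
move=> T_lin T_sa T_psd; set c := ip (T x) y.
have TZ d z : T (d *: z) = d *: T z by exact: (linearZ_LR (linear_op_of T_lin)).
have T0 : forall z, 0 <= rip (T z) z by apply/psd_rip.
have [N0|N0] := eqVneq (sqnormc c) 0; first by rewrite N0 mulr_ge0.
have N_gt0 : 0 < sqnormc c by rewrite lt_def N0 sqnormc_ge0.
have := psd_cauchy_schwarz (conjc c *: x) y T_lin T_sa T_psd.
rewrite /rip !TZ !ipZl ipZr -/c conjcK mulrC sqnormcE (mulrA _ c) (mulrC _ c).
by rewrite sqnormcE ReZ expr2 -mulrA ler_pM2l.
Qed.

Lemma complex_cauchy_schwarz x y : sqnormc (ip x y) <= rip x x * rip y y.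
Proof.
have := @complex_psd_cauchy_schwarz idfun x y.
by apply=> // z; exact: dnorm_ge0.
Qed.

Lemma continuous_ipl y : continuous (fun x => ip x y : R[i]^o).
Proof.
have L : linear (fun x => ip x y : R[i]^o).
  by move=> c x z; rewrite ipDl ipZl.
pose f : {linear h -> R[i]^o} := HB.pack (fun x => ip x y : R[i]^o)
  (GRing.isLinear.Build _ _ _ _ (fun x => ip x y : R[i]^o) L).
suff: continuous f by [].
apply/bounded_linear_continuous/linear_boundedP.
near=> r => x; rewrite norm_rip.
apply: (@le_trans _ _ ((Num.sqrt (rip y y))%:C%C * (Num.sqrt (rip x x))%:C%C)).
  rewrite -(@ler_pXn2r _ 2) ?(nnegrE, normr_ge0)//; last first.
    by rewrite -rmorphM ler0c mulr_ge0 ?sqrtr_ge0.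
  rewrite sqnormc_norm -rmorphM -rmorphXn lecR exprMn !sqr_sqrtr ?rip_ge0//.
  by rewrite mulrC complex_cauchy_schwarz.
rewrite ler_wpM2r ?ler0c ?sqrtr_ge0//.
by near: r; apply: nbhs_pinfty_ge; rewrite realE ler0c sqrtr_ge0.
Unshelve. all: by end_near. Qed.

Lemma ip_psumr (I : Type) (s : seq I) (F : I -> h) x :
  ip x (\sum_(i <- s) F i) = \sum_(i <- s) ip x (F i).
Proof.
elim: s => [|i s IHs]; last by rewrite !big_cons ipDr IHs.
by rewrite !big_nil ip0r.
Qed.

Lemma ip_psuml (I : Type) (s : seq I) (F : I -> h) x :
  ip (\sum_(i <- s) F i) x = \sum_(i <- s) ip (F i) x.
Proof.
rewrite ipC ip_psumr rmorph_sum; apply: eq_bigr => i _; exact/esym/ipC.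
Qed.

(** * Fourier expansion and Parseval's identity *)

Section Basis.
Variable E : set h.
Hypothesis E_basis : orthonormal_basis ip E.

(** Terms outside [E] count as [0], so that the sums form a net over all finite subsets of [h], as
    the sums in [trace] do. *)
Definition fourier_sum y (F : {fset h}) : h :=
  \sum_(e <- F) (if e \in E then ip y e *: e else 0).

Definition fourier_sqsum y (F : {fset h}) : R :=
  \sum_(e <- F) (if e \in E then sqnormc (ip y e) else 0).

Lemma ip_basis e f : E e -> E f -> ip e f = (e == f)%:R.
Proof. by move=> Ee Ef; apply: (proj1 E_basis). Qed.

Lemma ip_fourier_sum y F : ip y (fourier_sum y F) = (fourier_sqsum y F)%:C%C.
Proof.
rewrite ip_psumr rmorph_sum; apply: eq_bigr => e _.
case: ifP => _; first by rewrite ipZr mulrC sqnormcE.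
by rewrite ip0r.
Qed.

Lemma ip_fourier_sum_basis y F e : E e ->
  ip (fourier_sum y F) e = if e \in F then ip y e else 0.
Proof.
move=> Ee; rewrite ip_psuml.
transitivity (\sum_(f <- F) (if f == e then ip y e else 0)).
  apply: eq_bigr => f _; case: ifPn => [/set_mem Ef|fE].
    rewrite ipZl (ip_basis Ef Ee); case: (eqVneq f e) => [->|_].
      by rewrite mulr1.
    by rewrite mulr0.
  rewrite ip0l; case: (eqVneq f e) => // fe.
  by move: fE; rewrite fe mem_set.
case: ifPn => [eF|eF].
  rewrite (big_fsetD1 e)//= eqxx big_seq big1 ?addr0// => f.
  by rewrite !inE => /andP[/negbTE ->].
rewrite big_seq big1// => f fF; case: eqP => // fe.
by move: eF; rewrite -fe fF.
Qed.

Lemma ip_fourier_sum_sub y (F G : {fset h}) : (F `<=` G)%fset ->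
  ip (fourier_sum y G) (fourier_sum y F) = (fourier_sqsum y F)%:C%C.
Proof.
move=> FG; rewrite ip_psumr rmorph_sum big_seq [RHS]big_seq.
apply: eq_bigr => e eF; case: ifPn => [/set_mem Ee|_].
  by rewrite ipZr ip_fourier_sum_basis// (fsubsetP FG)// mulrC sqnormcE.
by rewrite ip0r.
Qed.

Lemma rip_fourier_sumB y (F G : {fset h}) : (F `<=` G)%fset ->
  rip (fourier_sum y G - fourier_sum y F) (fourier_sum y G - fourier_sum y F)
  = fourier_sqsum y G - fourier_sqsum y F.
Proof.
move=> FG; rewrite !(ripDl, ripDr, ripNl, ripNr).
rewrite (ripC (fourier_sum y F) (fourier_sum y G)) /rip.
by rewrite !ip_fourier_sum_sub//=; ring.
Qed.

Lemma bessel y F : fourier_sqsum y F <= rip y y.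
Proof.
have := rip_ge0 (y - fourier_sum y F).
rewrite !(ripDl, ripDr, ripNl, ripNr) (ripC (fourier_sum y F) y) /rip.
by rewrite ip_fourier_sum ip_fourier_sum_sub//=; lra.
Qed.

(** By Bessel the squared sums have a supremum, and by Pythagoras a finite set nearly attaining it
    makes the net Cauchy. The limit has the coefficients of [y], and only [0] is orthogonal to the
    whole basis. *)
Lemma fourier_cvg y : fourier_sum y @ totally --> y.
Proof.
have cv : cvg (fourier_sum y @ totally).
  apply/cauchy_cvgP/cauchy_exP => eps eps_gt0.
  have epsE : eps = (Re eps)%:C%C.
    move: (ltW eps_gt0); case: (eps) => a b.
    by rewrite lecE /= => /andP[/eqP ->].
  rewrite epsE ltcR in eps_gt0.
  pose Q := [set fourier_sqsum y F | F in setT].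
  have Q_sup : has_sup Q.
    split; first by exists (fourier_sqsum y fset0), fset0.
    by exists (rip y y) => _ [F _ <-]; exact: bessel.
  have [|_ [F _ <-] supF] := @sup_adherent _ Q (Re eps ^+ 2) _ Q_sup.
    by rewrite exprn_gt0.
  exists (fourier_sum y F); exists F => // G /= FG.
  rewrite -ball_normE /= epsE norm_rip ltcR.
  rewrite -(@ltr_pXn2r _ 2) ?nnegrE ?sqrtr_ge0 ?ltW// sqr_sqrtr ?rip_ge0//.
  rewrite -opprB ripNl ripNr opprK rip_fourier_sumB//.
  rewrite ltrBlDr -ltrBlDl; apply: le_lt_trans supF.
  by rewrite lerB//; apply: sup_upper_bound => //; exists G.
have /cvg_ex[l lP] := cv; suff lE : l = y by rewrite lE in lP.
apply/eqP; rewrite eq_sym -subr_eq0; apply/eqP.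
apply: (proj2 E_basis) => e Ee; apply/eqP.
rewrite ipDl ipNl subr_eq0; apply/eqP.
have c1 : ip (fourier_sum y F) e @[F --> totally] --> (ip l e : R[i]^o).
  exact: (cvg_comp _ _ lP (@continuous_ipl e l)).
have c2 : ip (fourier_sum y F) e @[F --> totally] --> (ip y e : R[i]^o).
  apply: cvg_near_cst; exists [fset e]%fset => // G /=.
  by rewrite fsub1set => eG; rewrite ip_fourier_sum_basis ?eG.
exact: (cvg_unique (@norm_hausdorff _ R[i]^o) c2 c1).
Qed.

Lemma partial_sumE (V : zmodType) (f : h -> V) (F : {fset h}) :
  partial_sum f F = \sum_(e <- F) f e.
Proof. by rewrite big_seq_fsetE. Qed.

Lemma parseval x y :
  partial_sum ((fun e => ip x e * ip e y : R[i]^o) \_ E) @ totally --> ip x y.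
Proof.
have c := cvg_comp _ _ (@fourier_cvg x) (@continuous_ipl y x).
apply: (cvg_trans _ c); apply: near_eq_cvg; apply: nearW => F /=.
rewrite ip_psuml partial_sumE; apply: eq_bigr => e _.
rewrite patchE; case: ifP; rewrite ?ipZl//.
by rewrite ip0l.
Qed.

End Basis.

(** The operator [y y^*]. *)
Definition rank1 y x : h := ip x y *: y.

Lemma linear_rank1 y : linear (rank1 y).
Proof. by move=> c x z; rewrite /rank1 ipDl ipZl scalerDl scalerA. Qed.

Lemma bounded_rank1 y : bounded_op (rank1 y).
Proof.
apply: (@rip_bounded _ (rip y y ^+ 2) (@linear_rank1 y)) => x.
rewrite ripZZ expr2 mulrC -mulrA ler_wpM2l ?rip_ge0// mulrC.
exact: complex_cauchy_schwarz.
Qed.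

Lemma selfadjoint_rank1 y : selfadjoint ip (rank1 y).
Proof. by move=> x z; rewrite ipZl ipZr mulrC -ipC. Qed.

Lemma ip_rank1 y x : ip (rank1 y x) x = (sqnormc (ip x y))%:C%C.
Proof. by rewrite ipZl (ipC y x) sqnormcE. Qed.

Lemma psd_rank1 y : psd ip (rank1 y).
Proof. by move=> x; rewrite ip_rank1 ler0c sqnormc_ge0. Qed.

(** * Adjoints, absolute values and uniqueness of positive square roots *)

Lemma ip_ext x y : (forall z, ip x z = ip y z) -> x = y.
Proof.
move=> xy; apply/eqP; rewrite -subr_eq0 -(dnorm_eq0 ip) ipDl ipNl xy.
by rewrite subrr.
Qed.

Lemma adjoint_selfadjoint T : bounded_op T -> selfadjoint ip T ->
  adjoint ip T = T.
Proof.
move=> T_bd T_sa; rewrite /adjoint; case: xgetP => [S -> [_ S_adj]|/(_ T)[]//].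
apply/funext => y; apply: ip_ext => x.
by rewrite ipC -S_adj T_sa -ipC.
Qed.

(** The difference [D] has zero quadratic form, hence is positive, and Cauchy-Schwarz for its form
    at [x] and [D x] gives [|D x|^4 <= 0]. *)
Lemma psd_rip_eq T S : bounded_op T -> bounded_op S ->
  selfadjoint ip T -> selfadjoint ip S ->
  (forall x, rip (T x) x = rip (S x) x) -> T = S.
Proof.
move=> T_bd S_bd T_sa S_sa TS; apply/funext => x.
pose D z := T z + (-1)%:C%C *: S z.
have D_bd : bounded_op D by apply: bounded_opD => //; exact: bounded_opZ.
have D_sa : selfadjoint ip D by apply: selfadjointD => //; exact: selfadjointZ.
have D0 z : rip (D z) z = 0 by rewrite ripDl ripZl TS; ring.
have D_psd : psd ip D by apply/psd_rip => // z; rewrite D0.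
have := psd_cauchy_schwarz x (D x) (proj1 D_bd) D_sa D_psd.
rewrite D0 mul0r => le0; have : rip (D x) (D x) = 0.
  by apply/eqP; rewrite -sqrf_eq0 eq_le le0 sqr_ge0.
by move/rip_eq0; rewrite /D rmorphN1 scaleN1r => /eqP; rewrite subr_eq0 => /eqP.
Qed.

(** For self-adjoint operators [W^2 = T^2] amounts to [|W x| = |T x|], the form suited to
    [psd_sub]. *)
Definition is_absop T W : Prop :=
  [/\ bounded_op W, selfadjoint ip W, psd ip W
    & forall x, rip (W x) (W x) = rip (T x) (T x)].

(** The zero operator is the default of [xget]: any other value of [absop] comes from an actual
    square root, which thereby exists. *)
Lemma absop_spec T : bounded_op T -> selfadjoint ip T ->
  absop ip T <> (fun=> 0) -> is_absop T (absop ip T).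
Proof.
move=> T_bd T_sa; rewrite /absop adjoint_selfadjoint//.
case: xgetP => [W _ [W_bd W_sa W_psd WW] _|//]; split=> // x.
have WWx : W (W x) = T (T x) by have := congr1 (@^~ x) WW.
by rewrite (selfadjoint_rip _ _ W_sa) WWx -(selfadjoint_rip _ _ T_sa).
Qed.

(** A positive square root [W] of [T^2] satisfies [|W x| = |T x|], so [psd_sub] applies in both
    directions. *)
Lemma absop_psd T : bounded_op T -> selfadjoint ip T -> psd ip T ->
  absop ip T = T.
Proof.
move=> T_bd T_sa T_psd; rewrite /absop adjoint_selfadjoint//.
case: xgetP => [W _ [W_bd W_sa W_psd WW]|/(_ T)[]//].
have WT x : rip (W x) (W x) = rip (T x) (T x).
  have WWx : W (W x) = T (T x) by have := congr1 (@^~ x) WW.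
  by rewrite (selfadjoint_rip _ _ W_sa) WWx -(selfadjoint_rip _ _ T_sa).
apply: psd_rip_eq => // x; apply/eqP; rewrite eq_le !psd_sub// => z;
by rewrite WT.
Qed.

(** * Traces as limits of diagonal sums *)

Section Trace.
Local Notation E := (basis_of_space ip).
Hypothesis E_basis : orthonormal_basis ip E.

Definition diag_sum T (F : {fset h}) : R[i]^o :=
  partial_sum ((fun e => ip (T e) e : R[i]^o) \_ E) F.

Lemma trace_cvgE T (c : R[i]^o) : diag_sum T @ totally --> c -> trace ip T = c.
Proof.
move=> Tc; rewrite /trace /summability.sum.
exact: (cvg_lim (@norm_hausdorff _ R[i]^o) Tc).
Qed.

(** The diagonal coefficient at [e] is [<S y, e> <e, y>]: this is the Parseval sum of [S y] and
    [y]. *)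
Lemma trace_rank1 S y : linear S -> trace ip (S \o rank1 y) = ip (S y) y.
Proof.
move=> S_lin.
have SZ c x : S (c *: x) = c *: S x by exact: (linearZ_LR (linear_op_of S_lin)).
apply: trace_cvgE; apply: (cvg_trans _ (@parseval _ E_basis (S y) y)).
apply: near_eq_cvg; apply: nearW => F /=.
rewrite /diag_sum !partial_sumE; apply: eq_bigr => e _; rewrite !patchE.
by case: ifP => // _ /=; rewrite /rank1 SZ ipZl mulrC.
Qed.

Definition diag_esum T : \bar R := \esum_(e in E) (Re (ip (T e) e))%:E.

Lemma diag_esum_rank1 y : (diag_esum (rank1 y) < +oo)%E.
Proof.
apply: (@le_lt_trans _ _ (rip y y)%:E); last exact: ltry.
apply: ub_ereal_sup => _ [A [A_fin AE] <-].
rewrite fsbig_finite// sumEFin lee_fin.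
apply: le_trans (bessel E_basis y (fset_set A)).
rewrite /fourier_sqsum big_seq [leRHS]big_seq; apply: ler_sum => e.
rewrite in_fset_set// => /set_mem /AE Ee; rewrite ip_rank1/= mem_set//.
by rewrite /sqnormc (ipC e y); case: (ip y e) => a b /=; rewrite sqrrN.
Qed.

(** Links the extended sum in [trace_class] to the limit in [trace]: for a positive operator the
    diagonal sums are real, increasing and bounded. *)
Lemma trace_esum T : psd ip T -> (diag_esum T < +oo)%E ->
  exists s : R, diag_sum T @ totally --> (s%:C%C : R[i]^o).
Proof.
move=> T_psd T_fin.
have T_ge0 e : 0 <= Re (ip (T e) e) by have := T_psd e; rewrite lecE => /andP[].
have TE e : ip (T e) e = (Re (ip (T e) e))%:C%C.
  by have /ger0_Im := T_psd e; case: (ip (T e) e) => a b /= ->.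
have diagE F : diag_sum T F =
    (\sum_(e <- F) (if e \in E then Re (ip (T e) e) else 0))%:C%C.
  rewrite /diag_sum partial_sumE rmorph_sum; apply: eq_bigr => e _.
  by rewrite patchE; case: ifP.
pose s (F : {fset h}) : R :=
  \sum_(e <- F) (if e \in E then Re (ip (T e) e) else 0).
pose Q := [set s F | F in setT].
have s_le (F G : {fset h}) : (F `<=` G)%fset -> s F <= s G.
  move=> FG; rewrite /s big_seq.
  rewrite (eq_bigr (fun e => if e \in F then
      (if e \in E then Re (ip (T e) e) else 0) else 0)); last by move=> e ->.
  rewrite -big_seq (big_fset_incl _ FG); last by move=> e _ /negbTE ->.
  by apply: ler_sum => e _; case: ifP => _; case: ifP.
have Q_sup : has_sup Q.
  split; first by exists (s fset0), fset0.
  exists (fine (diag_esum T)) => _ [F _ <-].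
  rewrite -lee_fin fineK; last first.
    by rewrite ge0_fin_numE// esum_ge0// => e _; rewrite lee_fin.
  rewrite /diag_esum esum_mkcond; apply: esum_ge; exists [set` F].
    by split=> //; exact: finite_fset.
  rewrite fsbig_finite ?set_fsetK//= -sumEFin.
  by apply: lee_sum => e _; case: ifP.
exists (sup Q); apply/cvgrPdist_lt => eps eps_gt0.
have epsE : eps = (Re eps)%:C%C.
  by move: (ltW eps_gt0); case: (eps) => a b; rewrite lecE /= => /andP[/eqP ->].
rewrite epsE ltcR in eps_gt0.
have [_ [F _ <-] supF] := @sup_adherent _ Q (Re eps) eps_gt0 Q_sup.
exists F => // G /= /s_le FG; rewrite diagE -/(s G) -rmorphB/= normc_def/=.
rewrite expr0n/= addr0 sqrtr_sqr epsE ltcR.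
have GQ : s G <= sup Q by apply: sup_upper_bound => //; exists G.
by rewrite ger0_norm ?subr_ge0//; lra.
Qed.

Lemma cvg_diag_sumD T S (c d : R[i]^o) :
  diag_sum T @ totally --> c -> diag_sum S @ totally --> d ->
  diag_sum (fun x => T x + S x) @ totally --> c + d.
Proof.
move=> Tc Sd; apply: (cvg_trans _ (cvgD Tc Sd)).
apply: near_eq_cvg; apply: nearW => F.
rewrite -[LHS]/(diag_sum T F + diag_sum S F).
rewrite /diag_sum !partial_sumE -big_split; apply: eq_bigr => e _ /=.
by rewrite !patchE; case: ifP => _; rewrite ?ipDl// addr0.
Qed.

Lemma cvg_diag_sumZ a T (c : R[i]^o) : diag_sum T @ totally --> c ->
  diag_sum (fun x => a%:C%C *: T x) @ totally --> (a%:C%C * c : R[i]^o).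
Proof.
move=> Tc; apply: (cvg_trans _ (cvgZr (k := a%:C%C) Tc)).
apply: near_eq_cvg; apply: nearW => F.
rewrite -[LHS]/(a%:C%C * diag_sum T F).
rewrite /diag_sum !partial_sumE big_distrr; apply: eq_bigr => e _ /=.
by rewrite !patchE; case: ifP => _; rewrite ?ipZl// mulr0.
Qed.

End Trace.
End RealInnerProduct.

(** * The ordered space of self-adjoint trace class operators *)

Section TraceClassSpace.
Variables (R : realType) (h : completeNormedModType R[i]).
Variable ip : {dot h for Num.Def.conjC}.
Hypothesis h_hilbert : hilbert_ip ip.
Variables (X : completeNormedModType R) (op : X -> h -> h).
Hypothesis X_space : is_selfadjoint_trace_class_space ip op.
Implicit Types (u v w : X) (x y z : h) (a : R).

Local Notation Re := complex.Re.
Local Notation rip := (rip ip).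
Local Notation E := (basis_of_space ip).
Local Notation K := (positive_cone ip op).
Local Notation Psi := (Psi ip op).
Local Notation diag_sum := (diag_sum ip).

Lemma op_linear a u v x : op (a *: u + v) x = a%:C%C *: op u x + op v x.
Proof. exact: (selfadjoint_trace_linear X_space). Qed.

Lemma op0 x : op 0 x = 0.
Proof.
have := op_linear 1 0 0 x; rewrite scaler0 addr0 rmorph1 scale1r => /eqP.
by rewrite -subr_eq0 opprD addrA subrr sub0r oppr_eq0 => /eqP.
Qed.

Lemma opD u v x : op (u + v) x = op u x + op v x.
Proof. by rewrite -{1}(scale1r u) op_linear rmorph1 scale1r. Qed.

Lemma opZ a u x : op (a *: u) x = a%:C%C *: op u x.
Proof. by rewrite -(addr0 (a *: u)) op_linear op0 addr0. Qed.

Lemma opN u x : op (- u) x = - op u x.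
Proof. by rewrite -scaleN1r opZ rmorphN1 scaleN1r. Qed.

Lemma op_selfadjoint u : selfadjoint ip (op u).
Proof.
have : range op (op u) by exists u.
by rewrite (selfadjoint_trace_range X_space) => -[].
Qed.

Lemma op_trace_class u : trace_class ip (op u).
Proof.
have : range op (op u) by exists u.
by rewrite (selfadjoint_trace_range X_space) => -[].
Qed.

Lemma op_bounded u : bounded_op (op u).
Proof. by case: (op_trace_class u). Qed.

Lemma op_onto T : selfadjoint ip T -> trace_class ip T -> exists u, op u = T.
Proof.
move=> T_sa T_tr.
have : range op T by rewrite (selfadjoint_trace_range X_space).
by move=> [u _ uT]; exists u.
Qed.

Lemma norm_op u : (`|u|)%:C%C = trace ip (absop ip (op u)).
Proof. exact: (selfadjoint_trace_norm X_space). Qed.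

Lemma trace_empty T : E = set0 -> trace ip T = 0.
Proof.
move=> E0; apply: trace_cvgE.
apply: cvg_near_cst; apply: nearW => F.
rewrite /diag_sum partial_sumE big1// => e _.
by rewrite patchE E0 in_set0.
Qed.

(* Without a basis every trace would be [0], so that the trace norm would
   vanish, although the identity would be trace class. *)
Lemma basis_of_spaceP : orthonormal_basis ip E.
Proof.
have [//|noE] := pselect (orthonormal_basis ip E).
have E0 : E = set0.
  rewrite /basis_of_space; case: xgetP => // E' E'E E'_basis.
  by case: noE; rewrite /basis_of_space -E'E.
have X0 u : u = 0.
  apply/normr0_eq0/complexI; rewrite norm_op trace_empty//.
have [u uid] : exists u, op u = @idfun h.
  apply: op_onto => [//|]; split; first exact: bounded_id.
  by rewrite E0 esum_set0 ltry.
by rewrite E0; split=> [e f []|x _]; rewrite -[LHS]/(idfun x) -uid (X0 u) op0.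
Qed.

Local Notation E_basis := basis_of_spaceP.

Lemma trace0 : trace ip (fun=> 0 : h) = 0.
Proof.
apply: trace_cvgE; apply: cvg_near_cst; apply: nearW => F.
rewrite /diag_sum partial_sumE big1// => e _.
by rewrite patchE ip0l if_same.
Qed.

(** If [u] is nonzero then so is its trace norm, hence its [absop] is not the zero default and
    [absop_spec] applies. The operator of [0] is positive and is its own absolute value. *)
Lemma absopP u : is_absop ip (op u) (absop ip (op u)).
Proof.
have [->|u0] := eqVneq u 0.
  have op00 : op 0 = fun=> 0 by apply/funext => x; exact: op0.
  have psd0 : psd ip (op 0) by move=> x; rewrite op0 ip0l.
  rewrite absop_psd//; [|exact: op_bounded|exact: op_selfadjoint].
  by split; [exact: op_bounded|exact: op_selfadjoint| |].
apply: absop_spec => //; [exact: op_bounded|exact: op_selfadjoint|].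
move=> a0; move: u0; rewrite -normr_eq0 -(inj_eq (@complexI R)) norm_op a0.
by rewrite trace0 eqxx.
Qed.

(** [|u|] is its own absolute value, so it inherits the trace class condition from [u]. *)
Lemma op_absop u : exists v, op v = absop ip (op u).
Proof.
have [w_bd w_sa w_psd _] := absopP u.
apply: op_onto => //; split=> //; rewrite absop_psd//.
by have [] := op_trace_class u.
Qed.

Lemma psd_op u : K u <-> forall x, 0 <= rip (op u x) x.
Proof. exact: (psd_rip (op_selfadjoint u)). Qed.

Lemma Psi_norm u : K u -> Psi u = `|u|.
Proof.
move=> Ku; rewrite /Defs.Psi -[in LHS](absop_psd h_hilbert _ _ Ku).
- by rewrite -norm_op.
- exact: op_bounded.
- exact: op_selfadjoint.
Qed.

Lemma cone0 : K 0.
Proof. by move=> x; rewrite op0 ip0l. Qed.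

Lemma coneD u v : K u -> K v -> K (u + v).
Proof. by move=> Ku Kv x; rewrite opD ipDl addr_ge0. Qed.

Lemma coneZ a u : 0 <= a -> K u -> K (a *: u).
Proof. by move=> a0 Ku x; rewrite opZ ipZl mulr_ge0 ?ler0c. Qed.

Lemma cvg_trace_cone u : K u ->
  diag_sum (op u) @ totally --> ((Psi u)%:C%C : R[i]^o).
Proof.
move=> Ku; have [_ fin] := op_trace_class u.
rewrite absop_psd// in fin; [|exact: op_bounded|exact: op_selfadjoint].
have [s sP] := trace_esum Ku fin.
by rewrite /Defs.Psi (trace_cvgE sP).
Qed.

Lemma Psi_coneD u v : K u -> K v -> Psi (u + v) = Psi u + Psi v.
Proof.
move=> Ku Kv; rewrite {1}/Defs.Psi.
have -> : op (u + v) = fun x => op u x + op v x.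
  by apply/funext => x; rewrite opD.
by rewrite (trace_cvgE (cvg_diag_sumD (cvg_trace_cone Ku) (cvg_trace_cone Kv))).
Qed.

(* |u| dominates both u and -u, by [psd_sub]. *)
Lemma cone_decomposition u : exists u1 u2, [/\ K u1, K u2, u = u1 - u2,
  `|u1| + `|u2| = `|u| &
  forall x, op u x = 0 -> op u1 x = 0 /\ op u2 x = 0].
Proof.
have [v vE] := op_absop u.
have [w_bd w_sa w_psd wu] := absopP u; rewrite -vE in w_bd w_sa w_psd wu.
have vu x : rip (op u x) x <= rip (op v x) x.
  apply: psd_sub => // [||z]; [exact: op_bounded|exact: op_selfadjoint|].
  by rewrite wu.
have vNu x : - rip (op u x) x <= rip (op v x) x.
  rewrite -ripNl -opN.
  apply: psd_sub => // [||z]; [exact: op_bounded|exact: op_selfadjoint|].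
  by rewrite wu opN ripNl ripNr opprK.
have Ku1 : K (2^-1 *: (v + u)).
  by apply/psd_op => x; rewrite opZ opD ripZl ripDl; have := vNu x; lra.
have Ku2 : K (2^-1 *: (v - u)).
  apply/psd_op => x; rewrite opZ opD opN ripZl ripDl ripNl.
  by have := vu x; lra.
have half2 w : 2^-1 *: w + 2^-1 *: w = w :> X.
  by rewrite -scalerDl -[X in X *: _](_ : 1 = _) ?scale1r//; field.
exists (2^-1 *: (v + u)), (2^-1 *: (v - u)); split => //.
- by rewrite -scalerBr opprB addrA addrAC (addrC v u) addrK scalerDr half2.
(* On the cone the norm is the trace, which is additive there; the two parts add up to [|u|], whose
   trace is the norm of [u]. *)
- rewrite -(Psi_norm Ku1) -(Psi_norm Ku2) -(Psi_coneD Ku1 Ku2) -scalerDr.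
  rewrite addrACA subrr addr0 scalerDr half2.
  rewrite Psi_norm//; apply: complexI; rewrite !norm_op -vE.
  by rewrite absop_psd.
(* [|u| x] and [u x] have the same length. *)
- move=> x ux; have vx : op v x = 0.
    by apply: (@rip_eq0 _ _ ip); rewrite wu ux rip0l.
  by rewrite !opZ !opD opN ux vx subrr addr0 scaler0.
Qed.

Lemma cvg_trace u : diag_sum (op u) @ totally --> ((Psi u)%:C%C : R[i]^o).
Proof.
have [u1 [u2 [Ku1 Ku2 uE _ _]]] := cone_decomposition u.
have opE : op u = fun x => op u1 x + (-1)%:C%C *: op u2 x.
  by apply/funext => x; rewrite uE opD opN rmorphN1 scaleN1r.
have c := cvg_diag_sumD (cvg_trace_cone Ku1)
  (cvg_diag_sumZ (a := -1) (cvg_trace_cone Ku2)).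
rewrite -opE in c; have := trace_cvgE c.
by rewrite /Defs.Psi => ->; rewrite -rmorphM -rmorphD /= rmorphD rmorphM.
Qed.

Lemma Psi_linear a u v : Psi (a *: u + v) = a * Psi u + Psi v.
Proof.
rewrite {1}/Defs.Psi.
have -> : op (a *: u + v) = fun x => a%:C%C *: op u x + op v x.
  by apply/funext => x; rewrite op_linear.
have c := cvg_diag_sumD (cvg_diag_sumZ (a := a) (@cvg_trace u)) (@cvg_trace v).
rewrite (trace_cvgE c).
by rewrite ReD ReZ.
Qed.

Lemma PsiZ a u : Psi (a *: u) = a * Psi u.
Proof.
have P0 : Psi 0 = 0 by rewrite Psi_norm ?normr0//; exact: cone0.
by rewrite -[a *: u]addr0 Psi_linear P0 addr0.
Qed.

Lemma PsiB u v : Psi (u - v) = Psi u - Psi v.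
Proof. by rewrite addrC -scaleN1r Psi_linear mulN1r addrC. Qed.

Lemma op_rank1 y : exists u, op u = rank1 ip y.
Proof.
apply: op_onto; first exact: selfadjoint_rank1.
split; first exact: bounded_rank1.
rewrite absop_psd//; [|exact: bounded_rank1|exact: selfadjoint_rank1
  |exact: psd_rank1].
by apply: diag_esum_rank1 => //; exact: E_basis.
Qed.

(* Cauchy-Schwarz for the form [z, x |-> <u z, x>] *)
Lemma cone_sub_rank1 u v x : K u -> op v = rank1 ip (op u x) ->
  K (rip (op u x) x *: u - v).
Proof.
move=> Ku vE; apply/psd_op => z.
rewrite opD opN opZ ripDl ripNl ripZl vE.
rewrite [X in _ - X](_ : _ = sqnormc (ip (op u z) x)); last first.
  by rewrite /rip ip_rank1 /= -op_selfadjoint.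
rewrite subr_ge0 mulrC.
have [u_lin _] := op_bounded u.
exact: (complex_psd_cauchy_schwarz z x u_lin (op_selfadjoint u) Ku).
Qed.

Lemma Psi_rank1 v y : op v = rank1 ip y -> Psi v = rip y y.
Proof.
move=> vE; rewrite /Defs.Psi vE.
by rewrite -[rank1 ip y]/(idfun \o rank1 ip y) trace_rank1//; exact: E_basis.
Qed.

(** The positive operator of [cone_sub_rank1] has nonnegative trace, so [|u x|^2] is at most
    [<u x, x>] times the norm of [u]. Insert this into [<u x, x>^2 <= |u x|^2 |x|^2] and cancel
    [<u x, x>]. *)
Lemma cone_rip_le u x : K u -> rip (op u x) x <= `|u| * rip x x.
Proof.
move=> Ku; have [v vE] := op_rank1 (op u x).
have := normr_ge0 (rip (op u x) x *: u - v).
rewrite -(Psi_norm (cone_sub_rank1 Ku vE)) PsiB PsiZ (Psi_rank1 vE) Psi_norm//.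
have /psd_op/(_ x) := Ku; have := cauchy_schwarz ip (op u x) x.
have := rip_ge0 ip x; have := normr_ge0 u.
move: (rip (op u x) (op u x)) (rip (op u x) x) (rip x x) `|u| => c b a n.
move=> n0 a0 cs b0 bn; have [->|b_neq0] := eqVneq b 0; first exact: mulr_ge0.
have b_gt0 : 0 < b by rewrite lt_def b_neq0.
rewrite -(ler_pM2l b_gt0) -expr2 (le_trans cs)// mulrA ler_wpM2r//; lra.
Qed.

Lemma op_rip_le u x : `|rip (op u x) x| <= `|u| * rip x x.
Proof.
have [u1 [u2 [Ku1 Ku2 -> <- _]]] := cone_decomposition u.
have := cone_rip_le x Ku1; have := cone_rip_le x Ku2.
have /psd_op/(_ x) := Ku1; have /psd_op/(_ x) := Ku2.
rewrite opD opN ripDl ripNl mulrDl ler_norml => a1 a2 a3 a4.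
by apply/andP; split; lra.
Qed.

Lemma closed_cone : closed K.
Proof.
move=> u Ku; apply/psd_op => x; rewrite leNgt; apply/negP => ux.
have xx : 0 <= rip x x by exact: rip_ge0.
(* [e (|x|^2 + 1) = - <u x, x>], so by [op_rip_le] the form at [x] stays negative within distance
   [e] of [u]. *)
pose e := - rip (op u x) x / (rip x x + 1).
have e_gt0 : 0 < e by rewrite divr_gt0 ?oppr_gt0// ltr_wpDl.
have [v [Kv uv]] := Ku _ (nbhsx_ballx u e e_gt0).
rewrite -ball_normE /= in uv.
have /psd_op/(_ x) vx := Kv; have := op_rip_le (u - v) x.
rewrite opD opN ripDl ripNl ler_norml => /andP[le1 _].
have le2 : `|u - v| * rip x x <= e * rip x x by rewrite ler_wpM2r// ltW.
have eE : e * (rip x x + 1) = - rip (op u x) x.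
  by rewrite /e divfK// gt_eqF// ltr_wpDl.
lra.
Qed.

End TraceClassSpace.

(** * Substochastic semigroups and their resolvents *)

Lemma subr_cross (V : zmodType) (a b c p q : V) :
  a - b - c = (p - q - c) + ((a - p) - (b - q)).
Proof.
rewrite -{1}(subrK p a) -{1}(subrK q b) opprD addrACA.
by rewrite -[LHS]addrA addrC.
Qed.

Lemma subr_subst (V : zmodType) (w f p f' p' : V) :
  w - f - p = (w - f' - p') + ((f' - f) + (p' - p)).
Proof.
rewrite [f' - f + _]addrACA -(opprD f p) -!(addrA w) -!opprD.
by rewrite addKr.
Qed.

Lemma cvg_expR_mul (R : realType) (a : R) :
  expR (a * t) @[t --> 0^'+] --> (1 : R).
Proof.
have e_cont : continuous (fun t : R => expR (a * t)).
  move=> t; apply: (@continuous_comp _ _ _ (fun t => a * t) expR).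
    by apply: cvgMr; exact: cvg_id.
  exact: continuous_expR.
by have := cvg_at_right_filter (e_cont 0); rewrite mulr0 expR0.
Qed.

Section Semigroup.
Variables (R : realType) (X : completeNormedModType R) (K : set X).
Implicit Types (u v w z : X) (a s t l : R) (T : R -> X -> X).

(** What the semigroup theory uses of the cone. Splitting with additive norms carries norm bounds
    from [K] to all of [X] with the same constant. *)
Definition state_space : Prop :=
  [/\ closed K, K 0, forall u v, K u -> K v -> K (u + v),
      forall a u, 0 <= a -> K u -> K (a *: u)
    & forall u, exists u1 u2, [/\ K u1, K u2, u = u1 - u2
                                & `|u1| + `|u2| = `|u|]].

Hypothesis K_space : state_space.

(** * Substochastic semigroups as contraction semigroups *)

Section Contraction.
Variable T : R -> X -> X.
Hypothesis T_sub : substochastic K T.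

Lemma semigroup_linear t a u v : 0 <= t ->
  T t (a *: u + v) = a *: T t u + T t v.
Proof. by move=> t0; have [[/(_ _ t0)[+ _] _ _ _] _] := T_sub; apply. Qed.

Lemma semigroup0 u : T 0 u = u.
Proof. by have [[]] := T_sub. Qed.

Lemma semigroupD s t u : 0 <= s -> 0 <= t -> T (s + t) u = T s (T t u).
Proof. by move=> s0 t0; have [[_ _ + _] _] := T_sub; apply. Qed.

Lemma semigroup_cvg u : T t u @[t --> 0^'+] --> u.
Proof. by have [[_ _ _ +] _] := T_sub; apply. Qed.

Lemma semigroup_positive t u : 0 <= t -> K u -> K (T t u).
Proof. by move=> t0 Ku; have [_ /(_ _ t0)[+ _]] := T_sub; apply. Qed.

Lemma semigroup_zero t : 0 <= t -> T t 0 = 0.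
Proof.
move=> t0; have := semigroup_linear (-1) 0 0 t0.
by rewrite scaler0 addr0 scaleN1r addNr.
Qed.

Lemma semigroupB t u v : 0 <= t -> T t (u - v) = T t u - T t v.
Proof.
by move=> t0; rewrite addrC -scaleN1r semigroup_linear// scaleN1r addrC.
Qed.

Lemma semigroupZ t a u : 0 <= t -> T t (a *: u) = a *: T t u.
Proof.
by move=> t0; rewrite -[a *: u]addr0 semigroup_linear// semigroup_zero// addr0.
Qed.

Lemma semigroup_contraction t u : 0 <= t -> `|T t u| <= `|u|.
Proof.
move=> t0; have [_ _ _ _ /(_ u)[u1 [u2 [Ku1 Ku2 -> <-]]]] := K_space.
have [_ /(_ _ t0)[_ le_norm]] := T_sub.
by rewrite semigroupB// (le_trans (ler_normB _ _))// lerD// le_norm.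
Qed.

Definition has_generator u v : Prop :=
  t^-1 *: (T t u - u) @[t --> 0^'+] --> v.

Lemma generatorP u v :
  has_generator u v <-> opdom (generator T) u /\ generator T u = v.
Proof.
split=> [uv|[/= u_dom <-]//].
by split; [apply/cvg_ex; exists v|exact: (cvg_lim _ uv)].
Qed.

Lemma has_generator_linear a u v u' v' :
  has_generator u u' -> has_generator v v' ->
  has_generator (a *: u + v) (a *: u' + v').
Proof.
move=> u_gen v_gen.
have c : a *: (t^-1 *: (T t u - u)) + t^-1 *: (T t v - v) @[t --> 0^'+] -->
    a *: u' + v' by apply: cvgD => //; apply: cvgZr.
apply: (cvg_trans _ c); apply: near_eq_cvg; near=> t.
have t0 : 0 <= t by near: t; exact: nbhs_right_ge.
rewrite semigroup_linear// scalerA mulrC -scalerA -scalerDr scalerBr.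
by rewrite opprD addrACA.
Unshelve. all: by end_near. Qed.

(** With [(T t u - u) / t] in place of the generator, the norm is at least
    [(l + 1/t) |u| - |T t u| / t >= l |u|]; then [t] tends to [0]. *)
Lemma dissipative l u : 0 < l -> opdom (generator T) u ->
  l * `|u| <= `|l *: u - generator T u|.
Proof.
move=> l_gt0 u_dom.
have c : `|l *: u - t^-1 *: (T t u - u)| @[t --> 0^'+] -->
    `|l *: u - generator T u|.
  by apply: cvg_norm; apply: cvgB => //; exact: cvg_cst.
apply: (cvgr_to_ge c); near=> t.
have t0 : 0 < t by near: t; exact: nbhs_right_gt.
have -> : l *: u - t^-1 *: (T t u - u) = (l + t^-1) *: u - t^-1 *: T t u.
  by rewrite scalerBr opprB scalerDl addrA.
rewrite (le_trans _ (lerB_dist _ _))// !normrZ !gtr0_norm ?addr_gt0 ?invr_gt0//.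
rewrite mulrDl -addrA lerDl subr_ge0 ler_wpM2l ?invr_ge0 ?(ltW t0)//.
exact: semigroup_contraction (ltW t0).
Unshelve. all: by end_near. Qed.

(** * Construction of the resolvent from Riemann sums *)

Section Resolvent.
Variable l : R.
Hypothesis l_gt0 : 0 < l.

(** The factor [e^{-l t}] shifts the generator by [-l]; the resolvent at [l] is the integral of this
    family over [t >= 0]. *)
Definition damped t u : X := expR (- (l * t)) *: T t u.

Lemma dampedD s t u : 0 <= s -> 0 <= t ->
  damped (s + t) u = damped s (damped t u).
Proof.
move=> s0 t0; rewrite /damped semigroupD// semigroupZ// scalerA -expRD.
by rewrite mulrDr opprD.
Qed.

Lemma damped0 u : damped 0 u = u.
Proof. by rewrite /damped mulr0 oppr0 expR0 scale1r semigroup0. Qed.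

Lemma dampedB t u v : 0 <= t -> damped t (u - v) = damped t u - damped t v.
Proof. by move=> t0; rewrite /damped semigroupB// scalerBr. Qed.

Lemma dampedZ t a u : 0 <= t -> damped t (a *: u) = a *: damped t u.
Proof. by move=> t0; rewrite /damped semigroupZ// !scalerA mulrC. Qed.

Lemma norm_damped t u : 0 <= t -> `|damped t u| <= expR (- (l * t)) * `|u|.
Proof.
move=> t0; rewrite normrZ ger0_norm ?expR_ge0// ler_wpM2l ?expR_ge0//.
exact: semigroup_contraction.
Qed.

Lemma damped_contraction t u : 0 <= t -> `|damped t u| <= `|u|.
Proof.
move=> t0; rewrite (le_trans (norm_damped u t0))// ler_piMl// expR_le1.
by rewrite oppr_le0 mulr_ge0// ltW.
Qed.

Lemma damped_cvg u : damped t u @[t --> 0^'+] --> u.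
Proof.
have e1 : expR (- (l * t)) @[t --> 0^'+] --> (1 : R).
  by under eq_fun do rewrite -mulNr; exact: cvg_expR_mul.
have c := cvgZ e1 (@semigroup_cvg u).
rewrite scale1r in c; exact: c.
Qed.

Lemma damped_modulus u e : 0 < e ->
  exists2 d, 0 < d & forall s, 0 <= s -> s <= d -> `|damped s u - u| <= e.
Proof.
move=> e_gt0; have /cvgrPdist_le/(_ _ e_gt0) := @damped_cvg u.
rewrite near_withinE => -[d /= d_gt0 dP].
exists (d / 2); first by rewrite divr_gt0.
move=> s; rewrite le_eqVlt => /predU1P[<- _|s_gt0 sd].
  by rewrite damped0 subrr normr0 ltW.
rewrite distrC; apply: dP => //=; rewrite sub0r normrN gtr0_norm//.
by rewrite (le_lt_trans sd)// gtr_pMr// invf_lt1// ltr1n.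
Qed.

(** [damped t] shrinks norms by [e^{-l t}], and [1 - e^{-l t} >= l t / (1 + l t) >= l t / (1 + l)]
    for [t <= 1]. Being linear in [t], the bound absorbs errors of size [t e]. *)
Lemma one_damped_norm t v : 0 < t -> t <= 1 ->
  t * `|v| <= (1 + l) / l * `|v - damped t v|.
Proof.
move=> t_gt0 t1; rewrite mulrAC ler_pdivlMr//.
have : (1 + l) * (`|v| - `|damped t v|) <= (1 + l) * `|v - damped t v|.
  by rewrite ler_wpM2l ?lerB_dist// ltW// addr_gt0.
apply: le_trans; have := norm_damped v (ltW t_gt0).
have e1 := expR_ge1Dx (l * t); have lt_gt0 : 0 < l * t by rewrite mulr_gt0.
rewrite expRN => Fv.
have : (1 + l * t) * `|damped t v| <= `|v|.
  rewrite -ler_pdivlMl ?addr_gt0// (le_trans Fv)// ler_wpM2r//.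
  by rewrite lef_pV2 ?posrE ?expR_gt0 ?addr_gt0.
have := normr_ge0 v; have := normr_ge0 (damped t v).
have lt_l : l * t <= l by rewrite -[leRHS]mulr1 ler_pM2l.
move: (`|v|) (`|damped t v|) => a b b0 a0 ab.
have lb : 0 <= l * t * b by rewrite mulr_ge0// ltW.
have : 0 <= (l - l * t) * (a - b) by rewrite mulr_ge0 ?subr_ge0//; lra.
lra.
Qed.

(** The solution is the Riemann sum [t (u + F u + F^2 u + ...)] with [F = damped t]. The contraction
    principle runs inside the closed set [K], so positivity comes with existence. *)
Lemma damped_fixed u t : K u -> 0 < t ->
  exists2 z, K z & z = damped t z + t *: u.
Proof.
move=> Ku t_gt0; have [K_closed K_0 K_D K_Z _] := K_space.
pose f z := damped t z + t *: u.
have fK : set_fun K K f.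
  move=> z Kz; apply: K_D; last exact: K_Z (ltW t_gt0) Ku.
  by apply: K_Z; [exact: expR_ge0|apply: semigroup_positive => //; exact: ltW].
pose g : {fun K >-> K} := HB.pack f (isFun.Build _ _ K K f fK).
have [|//||z Kz zE] := @banach_fixed_point R X K g; last by exists z.
  exists (NngNum (expR_ge0 (- (l * t)))); split => /=.
    by rewrite expR_lt1 oppr_lt0 mulr_gt0.
  move=> [x y] _ /=; rewrite /f opprD addrACA subrr addr0.
  rewrite -dampedB ?(ltW t_gt0)//.
  exact: norm_damped (ltW t_gt0).
by exists 0.
Qed.

Lemma damped_sum h u z n : 0 <= h -> z = damped h z + h *: u ->
  z - damped (n%:R * h) z = h *: \sum_(j < n) damped (j%:R * h) u.
Proof.
move=> h_ge0 zE; elim: n => [|n IHn].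
  by rewrite mul0r damped0 subrr big_ord0 scaler0.
have nh : 0 <= n%:R * h by rewrite mulr_ge0.
rewrite big_ord_recr/= scalerDr -IHn -natr1 mulrDl mul1r dampedD//.
rewrite -dampedZ// (_ : h *: u = z - damped h z); last first.
  by rewrite {1}zE addrAC subrr add0r.
by rewrite dampedB// addrA subrK.
Qed.

(** Each term of [damped_sum] is within [e] of [u], so the fixed point for the fine step [h] nearly
    satisfies the equation for the coarse step [n h]. *)
Lemma damped_sum_le h u z n e d : 0 <= h -> z = damped h z + h *: u ->
  n%:R * h <= d -> (forall s, 0 <= s -> s <= d -> `|damped s u - u| <= e) ->
  `|z - damped (n%:R * h) z - (n%:R * h) *: u| <= n%:R * h * e.
Proof.
move=> h_ge0 zE nd dP; rewrite (damped_sum n h_ge0 zE).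
have -> : (n%:R * h) *: u = h *: \sum_(j < n) u.
  by rewrite sumr_const card_ord mulrC -scalerA scaler_nat.
have -> : n%:R * h * e = h * \sum_(j < n) e.
  by rewrite sumr_const card_ord -[e *+ n]mulr_natl; ring.
rewrite -scalerBr -sumrB normrZ ger0_norm// ler_wpM2l//.
rewrite (le_trans (ler_norm_sum _ _ _))//; apply: ler_sum => j _.
apply: dP; first by rewrite mulr_ge0.
by rewrite (le_trans _ nd)// ler_wpM2r// ler_nat ltnW.
Qed.

Lemma resolvent_exists_cone u : K u ->
  exists w, [/\ K w, opdom (generator T) w & l *: w - generator T w = u].
Proof.
(* Dyadic steps: each is an integer multiple of every finer one. *)
move=> Ku; pose h n : R := 2^-1 ^+ n.
have h_gt0 n : 0 < h n by rewrite exprn_gt0.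
have h_le1 n : h n <= 1 by rewrite exprn_ile1// invf_le1// ler1n.
have hE m n : (m <= n)%N -> h m = (2 ^ (n - m))%:R * h n.
  move=> mn; rewrite /h -{2}(subnK mn) exprD mulrA natrX -exprMn divff//.
  by rewrite expr1n mul1r.
have /choice[z zP] : forall n, exists z, K z /\ z = damped (h n) z + h n *: u.
  by move=> n; have [z Kz zE] := damped_fixed Ku (h_gt0 n); exists z.
have zE n : z n = damped (h n) (z n) + h n *: u by case: (zP n).
(* [z n] nearly solves the equation of step [h m], which [z m] solves exactly; [one_damped_norm]
   bounds the difference. *)
have z_cauchy m n e : (m <= n)%N -> 0 < e ->
    (forall s, 0 <= s -> s <= h m -> `|damped s u - u| <= e) ->
    `|z n - z m| <= (1 + l) / l * e.
  move=> mn e_gt0 mP; rewrite -(ler_pM2l (h_gt0 m)).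
  apply: (le_trans (one_damped_norm (z n - z m) (h_gt0 m) (h_le1 m))).
  rewrite mulrCA ler_wpM2l ?divr_ge0 ?addr_ge0 ?(ltW l_gt0)//.
  have -> : z n - z m - damped (h m) (z n - z m)
     = z n - damped (h m) (z n) - h m *: u.
    have -> : h m *: u = z m - damped (h m) (z m).
      by rewrite {1}(zE m) addrAC subrr add0r.
    rewrite dampedB ?(ltW (h_gt0 m))// !opprB addrACA [RHS]addrACA.
    by rewrite [- z m - _]addrC.
  have := damped_sum_le (n := 2 ^ (n - m)) (ltW (h_gt0 n)) (zE n) _ mP.
  by rewrite -hE//; apply.
have h_small d : 0 < d -> exists m, h m <= d.
  move=> d_gt0; have h0 : h n @[n --> \oo] --> (0 : R).
    by apply: cvg_expr; rewrite ger0_norm ?invr_ge0// invf_lt1// ltr1n.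
  have /cvgrPdist_le/(_ _ d_gt0)[m _ mP] := h0.
  exists m; have := mP m (leqnn m); rewrite sub0r normrN.
  by rewrite ger0_norm// ltW.
have z_cvg : cvg (z n @[n --> \oo]).
  apply/cauchy_cvgP/cauchy_exP => eps eps_gt0.
  pose e := eps * l / (1 + l) / 2.
  have e_gt0 : 0 < e by rewrite !divr_gt0 ?mulr_gt0 ?addr_gt0.
  have [d d_gt0 dP] := damped_modulus u e_gt0.
  have [m md] := h_small _ d_gt0.
  exists (z m); exists m => // n /= mn.
  rewrite -ball_normE /= distrC.
  apply: le_lt_trans (z_cauchy m n e mn e_gt0 _) _ => [s s0 sm|].
    by apply: dP => //; exact: le_trans md.
  have -> : (1 + l) / l * e = eps / 2.
    by rewrite /e; field; rewrite !gt_eqF ?addr_gt0.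
  by rewrite gtr_pMr// invf_lt1// ltr1n.
have /cvg_ex[w zw] := z_cvg.
(* [damped_sum_le] passes to the limit [w] at times that are multiples of some [h m]. *)
have dyadic e d m k : 0 < e ->
    (forall s, 0 <= s -> s <= d -> `|damped s u - u| <= e) ->
    k%:R * h m <= d ->
    `|w - damped (k%:R * h m) w - (k%:R * h m) *: u| <= k%:R * h m * e.
  move=> e_gt0 dP kd; apply/ler_addgt0Pr => eta eta_gt0.
  have eta2 : 0 < eta / 2 by rewrite divr_gt0.
  have /cvgrPdist_le/(_ _ eta2)[N _ NP] := zw.
  pose n := maxn N m; have mn : (m <= n)%N by exact: leq_maxr.
  have wz : `|w - z n| <= eta / 2 by apply: NP; exact: leq_maxl.
  have tE : k%:R * h m = (k * 2 ^ (n - m))%:R * h n.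
    by rewrite natrM -mulrA -hE.
  have := damped_sum_le (n := k * 2 ^ (n - m)) (ltW (h_gt0 n)) (zE n) _ dP.
  rewrite -tE => /(_ kd); set t := k%:R * h m => zt.
  have t_ge0 : 0 <= t by rewrite mulr_ge0// ltW.
  have -> : w - damped t w - t *: u =
      (z n - damped t (z n) - t *: u) + ((w - z n) - damped t (w - z n)).
    by rewrite dampedB// -subr_cross.
  rewrite (le_trans (ler_normD _ _))// lerD// (le_trans (ler_normB _ _))//.
  by rewrite (splitr eta) lerD// (le_trans (damped_contraction _ _)).
(* Other times [t] are approximated from above by such multiples, using continuity of [damped] at
   [w]. *)
have w_le e d t : 0 < e ->
    (forall s, 0 <= s -> s <= d -> `|damped s u - u| <= e) ->
    0 < t -> t < d -> `|w - damped t w - t *: u| <= t * e.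
  move=> e_gt0 dP t_gt0 td; apply/ler_addgt0Pr => eta eta_gt0.
  (* The error is [eta / c] times this sum: [e] and [|u|] come from replacing [t] by [t'], and [1]
     from the continuity at [w]. *)
  pose c := e + 1 + `|u|.
  have c_gt0 : 0 < c by rewrite ltr_wpDr ?addr_gt0.
  have ec : 0 < eta / c by rewrite divr_gt0.
  have [d' d'_gt0 d'P] := damped_modulus w ec.
  have [m] : exists m, h m <= Num.min (Num.min d' (d - t)) (eta / c).
    by apply: h_small; rewrite !lt_min ec d'_gt0 subr_gt0 td.
  rewrite !le_min => /andP[/andP[hd' hd] hc].
  (* [t'] is the first multiple of [h m] strictly beyond [t], whence the successor. *)
  pose k := (Num.truncn (t / h m)).+1; pose t' := k%:R * h m.
  have tt' : t < t' by rewrite -ltr_pdivrMr// truncnS_gt.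
  have t't : t' - t <= h m.
    rewrite lerBlDr /t' -natr1 mulrDl mul1r addrC lerD2l -ler_pdivlMr//.
    by rewrite truncn_le// divr_ge0// ltW.
  have t'd : t' <= d by lra.
  have key := dyadic e d m k e_gt0 dP t'd; rewrite -/t' in key.
  have s_ge0 : 0 <= t' - t by rewrite subr_ge0 ltW.
  have Fs : `|damped (t' - t) w - w| <= eta / c by apply: d'P => //; lra.
  have -> : w - damped t w - t *: u = (w - damped t' w - t' *: u)
      + (damped t (damped (t' - t) w - w) + (t' - t) *: u).
    rewrite dampedB ?(ltW t_gt0)// -dampedD ?(ltW t_gt0)//.
    by rewrite [t + (t' - t)]addrC subrK scalerBl -subr_subst.
  rewrite (le_trans (ler_normD _ _))//.
  have : `|damped t (damped (t' - t) w - w) + (t' - t) *: u| <=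
         eta / c + eta / c * `|u|.
    rewrite (le_trans (ler_normD _ _))// lerD//.
      by rewrite (le_trans (damped_contraction _ (ltW t_gt0))).
    by rewrite normrZ ger0_norm// ler_wpM2r//; lra.
  have : t' * e <= (t + eta / c) * e by rewrite ler_wpM2r ?(ltW e_gt0)//; lra.
  have : eta = eta / c * e + eta / c + eta / c * `|u|.
    have : eta / c * c = eta by rewrite divfK// gt_eqF.
    by move: (eta / c) => q <-; rewrite /c; ring.
  lra.
have damped_gen : t^-1 *: (damped t w - w) @[t --> 0^'+] --> - u.
  apply/cvgrPdist_le => e e_gt0.
  have [d d_gt0 dP] := damped_modulus u e_gt0.
  near=> t.
  have t_gt0 : 0 < t by near: t; exact: nbhs_right_gt.
  have td : t < d by near: t; exact: nbhs_right_lt.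
  rewrite -(ler_pM2l t_gt0) -{1}(gtr0_norm t_gt0) -normrZ.
  apply: le_trans (w_le e d t e_gt0 dP t_gt0 td).
  rewrite scalerBr scalerA divff ?gt_eqF// scale1r opprB scalerN addrC.
  exact: lexx.
(* Squeeze between [l] and [l / (1 - l t)], using [1 + s <= e^s] at [s = l t] and at [s = - l t]. *)
have exp_gen : t^-1 * (expR (l * t) - 1) @[t --> 0^'+] --> l.
  apply: (@squeeze_cvgr _ _ _ _ (cst l) (fun t => l * (1 - l * t)^-1)).
  - near=> t.
    have t_gt0 : 0 < t by near: t; exact: nbhs_right_gt.
    have lt1 : l * t < 1.
      rewrite -ltr_pdivlMl// mulr1; near: t; apply: nbhs_right_lt.
      by rewrite invr_gt0.
    apply/andP; split.
      by rewrite /= mulrC ler_pdivlMr// lerBrDl expR_ge1Dx.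
    have e1 : 1 - l * t <= (expR (l * t))^-1 by rewrite -expRN expR_ge1Dx.
    rewrite mulrC ler_pdivrMr// mulrAC ler_pdivlMr ?subr_gt0//.
    have e_gt0 := expR_gt0 (l * t).
    have : expR (l * t) * (1 - l * t) <= 1.
      by rewrite -ler_pdivlMl// mulr1.
    lra.
  - exact: cvg_cst.
  - have c1 : l * t @[t --> 0^'+] --> (0 : R).
      have lc : continuous (fun t : R => l * t).
        by move=> t; apply: cvgMr; exact: cvg_id.
      by have := cvg_at_right_filter (lc 0); rewrite mulr0.
    have c2 : (1 - l * t)^-1 @[t --> 0^'+] --> ((1 - 0)^-1 : R).
      apply: cvgV; first by rewrite subr0 oner_eq0.
      by apply: cvgB => //; exact: cvg_cst.
    have c3 := cvgMr (a := l) c2.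
    by rewrite subr0 invr1 mulr1 in c3; exact: c3.
(* Undamping: [T t w - w = (e^{l t} - 1) w + e^{l t} (damped t w - w)]. *)
have w_gen : has_generator w (l *: w - u).
  have c : (t^-1 * (expR (l * t) - 1)) *: w
      + expR (l * t) *: (t^-1 *: (damped t w - w)) @[t --> 0^'+] --> l *: w - u.
    apply: cvgD; first exact: cvgZl.
    by rewrite -(scale1r (- u)); apply: cvgZ damped_gen; exact: cvg_expR_mul.
  apply: (cvg_trans _ c); apply: near_eq_cvg; near=> t.
  rewrite [X in _ + X]scalerA [_ * t^-1]mulrC -!scalerA -scalerDr.
  congr (_ *: _); rewrite scalerBr /damped scalerA -expRD subrr expR0 scale1r.
  by rewrite scalerBl scale1r addrC addrA subrK.
have /generatorP[w_dom w_eq] := w_gen.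
have [K_closed _ _ _ _] := K_space.
exists w; split=> //; last by rewrite w_eq opprB addrC subrK.
apply: (@closed_cvg _ _ _ _ z K K_closed _ _ zw).
by apply: nearW => n; case: (zP n).
Unshelve. all: by end_near. Qed.

End Resolvent.

(** * Algebra of the generator and its resolvent *)

Local Notation G := (generator T).

Lemma generator_linear a u v : opdom G u -> opdom G v ->
  opdom G (a *: u + v) /\ G (a *: u + v) = a *: G u + G v.
Proof.
by move=> u_dom v_dom; apply/generatorP; exact: has_generator_linear.
Qed.

Lemma generatorD u v : opdom G u -> opdom G v ->
  opdom G (u + v) /\ G (u + v) = G u + G v.
Proof. by move=> u_dom /(generator_linear 1 u_dom); rewrite !scale1r. Qed.

Lemma generatorB u v : opdom G u -> opdom G v ->
  opdom G (u - v) /\ G (u - v) = G u - G v.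
Proof.
move=> u_dom v_dom; have := generator_linear (-1) v_dom u_dom.
by rewrite !scaleN1r ![- _ + _]addrC.
Qed.

Lemma resolvent_unique l w z : 0 < l -> opdom G w -> opdom G z ->
  l *: w - G w = l *: z - G z -> w = z.
Proof.
move=> l_gt0 w_dom z_dom wz.
have [wz_dom wzE] := generatorB w_dom z_dom.
have := dissipative l_gt0 wz_dom.
have -> : l *: (w - z) - G (w - z) = 0.
  have lwE : l *: w = l *: z - G z + G w by rewrite -wz subrK.
  apply/eqP; rewrite wzE scalerBr subr_eq0 subr_eq lwE [eqbRHS]addrC -addrA.
  by rewrite [- _ + _]addrC.
rewrite normr0 pmulr_rle0// normr_le0 subr_eq0 => /eqP; exact.
Qed.

Lemma resolventP l u : 0 < l ->
  opdom G (resolvent G l u) /\ l *: resolvent G l u - G (resolvent G l u) = u.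
Proof.
move=> l_gt0; rewrite /resolvent; case: xgetP => // noR; exfalso.
have [_ _ _ _ /(_ u)[u1 [u2 [Ku1 Ku2 uE _]]]] := K_space.
have [w1 [_ w1_dom w1E]] := resolvent_exists_cone l_gt0 Ku1.
have [w2 [_ w2_dom w2E]] := resolvent_exists_cone l_gt0 Ku2.
have [w_dom wE] := generatorB w1_dom w2_dom.
apply: (noR (w1 - w2)); split => //.
by rewrite wE uE -w1E -w2E scalerBr !opprB addrACA [RHS]addrACA [- _ + _]addrC.
Qed.

Lemma resolvent_eq l u w : 0 < l -> opdom G w -> l *: w - G w = u ->
  resolvent G l u = w.
Proof.
move=> l_gt0 w_dom wE; have [r_dom rE] := resolventP u l_gt0.
by apply: (resolvent_unique l_gt0) => //; rewrite rE wE.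
Qed.

Lemma resolvent_positive l u : 0 < l -> K u -> K (resolvent G l u).
Proof.
move=> l_gt0 Ku; have [w [Kw w_dom wE]] := resolvent_exists_cone l_gt0 Ku.
by rewrite (resolvent_eq l_gt0 w_dom wE).
Qed.

Lemma resolvent_norm l u : 0 < l -> l * `|resolvent G l u| <= `|u|.
Proof.
move=> l_gt0; have [r_dom {2}<-] := resolventP u l_gt0.
exact: dissipative.
Qed.

Lemma resolvent_linear l a u v : 0 < l ->
  resolvent G l (a *: u + v) = a *: resolvent G l u + resolvent G l v.
Proof.
move=> l_gt0; have [u_dom uE] := resolventP u l_gt0.
have [v_dom vE] := resolventP v l_gt0.
have [w_dom wE] := generator_linear a u_dom v_dom.
apply: resolvent_eq => //; rewrite wE -{3}uE -{3}vE.
by rewrite scalerDr opprD addrACA scalerBr !scalerA mulrC.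
Qed.

Lemma resolvent_identity l m u : 0 < l -> 0 < m ->
  resolvent G l u
  = resolvent G m u + (m - l) *: resolvent G m (resolvent G l u).
Proof.
move=> l_gt0 m_gt0; rewrite addrC -resolvent_linear//.
have [r_dom rE] := resolventP u l_gt0.
apply/esym/resolvent_eq => //.
by rewrite -{4}rE scalerBl addrA subrK.
Qed.

End Contraction.
(** * The functionals [Xi] *)

Section Perturbation.
Variable psi : X -> R.
Hypothesis psi_linear : forall a u v, psi (a *: u + v) = a * psi u + psi v.
Hypothesis psi_norm : forall u, K u -> psi u = `|u|.
Variables U V : R -> X -> X.
Hypothesis U_sub : substochastic K U.
Hypothesis V_sub : substochastic K V.
Local Notation A := (generator U).
Local Notation G := (generator V).
Variable B : X -> X.
Hypothesis B_positive : positive_op K (opdom A) B.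
Hypothesis AB_psi :
  forall u, opdom A u -> K u -> psi (A u + B u) <= 0.
Hypothesis G_sum : extends_sum G A B.
Variable abar : X -> R.
Hypothesis abar_def : is_abar psi A B G abar.

Local Notation RA := (resolvent A).
Local Notation RG := (resolvent G).
Local Notation a0 := (a0 psi G).
Local Notation phi := (Xi psi G abar).

Let psiD u v : psi (u + v) = psi u + psi v.
Proof. by rewrite -{1}[u]scale1r psi_linear mul1r. Qed.

Let psiZ a u : psi (a *: u) = a * psi u.
Proof.
have psi0 : psi 0 = 0.
  by have := psi_linear 1 0 0; rewrite scaler0 addr0 mul1r; lra.
by rewrite -[a *: u]addr0 psi_linear psi0 addr0.
Qed.

Let psiB u v : psi (u - v) = psi u - psi v.
Proof. by rewrite addrC -scaleN1r psi_linear; lra. Qed.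

Lemma a0_resolvent l u : 0 < l -> a0 (RG l u) = psi u - l * psi (RG l u).
Proof.
move=> l_gt0; have [r_dom rE] := resolventP V_sub u l_gt0.
by rewrite /Defs.a0 -{2}rE psiB psiZ; ring.
Qed.

Lemma a0_resolvent_ge0 l u : 0 < l -> K u -> 0 <= a0 (RG l u).
Proof.
move=> l_gt0 Ku; rewrite a0_resolvent// !psi_norm//.
  by rewrite subr_ge0; exact: resolvent_norm.
exact: resolvent_positive.
Qed.

(** * Bounds on [Xi] from the iterates of [B (l - A)^{-1}] *)

Section Iterates.
Variables (l : R) (u : X).
Hypothesis l_gt0 : 0 < l.
Hypothesis Ku : K u.

Let v n := iter n (B \o RA l) u.
Let r n := RA l (v n).

Let Kv n : K (v n).
Proof.
elim: n => [//|n Kvn] /=; apply: B_positive.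
  by have [] := resolventP U_sub (v n) l_gt0.
exact: resolvent_positive.
Qed.

Let Kr n : K (r n).
Proof. exact: resolvent_positive. Qed.

Let a0_r_ge0 n : 0 <= a0 (r n).
Proof.
have [r_dom _] := resolventP U_sub (v n) l_gt0.
by rewrite oppr_ge0 (proj2 (G_sum r_dom)); exact: AB_psi (Kr n).
Qed.

(* [(l - G) (r 0 + ... + r (n-1)) = u - v n] *)
Let RG_split n : a0 (RG l u) = series (a0 \o r) n + a0 (RG l (v n)).
Proof.
elim: n => [|n IHn]; first by rewrite /series /= big_geq// add0r.
rewrite IHn seriesSr/= -addrA; congr (_ + _).
have [r_dom rE] := resolventP U_sub (v n) l_gt0.
have [rG_dom rGE] := G_sum r_dom.
have [s_dom sE] := resolventP V_sub (v n.+1) l_gt0.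
have [t_dom tE] := generatorD V_sub rG_dom s_dom.
have -> : RG l (v n) = r n + RG l (v n.+1).
  apply: resolvent_eq => //.
  rewrite tE scalerDr opprD addrACA sE rGE opprD addrA -/(r n) rE.
  by rewrite subrK.
by rewrite /Defs.a0 tE psiD opprD.
Qed.

Lemma Xi_ge0 : 0 <= phi l u.
Proof.
have [_ /(_ l u l_gt0) c] := abar_def.
rewrite subr_ge0; apply: (cvgr_to_le c); apply: nearW => n.
by rewrite (RG_split n) lerDl a0_resolvent_ge0.
Qed.

(** The terms [a0 (r n)] are nonnegative by the trace condition on [A + B], so [abar (RG l u) >= 0];
    moreover [a0 (RG l u) = |u| - l |RG l u|]. *)
Lemma Xi_le : phi l u <= `|u|.
Proof.
have [_ /(_ l u l_gt0) c] := abar_def.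
have abar_ge0 : 0 <= abar (RG l u).
  apply: (cvgr_to_ge c); apply: nearW => n.
  by apply: sumr_ge0 => i _; exact: a0_r_ge0.
rewrite /Xi a0_resolvent// -(psi_norm Ku).
have : 0 <= l * psi (RG l u).
  rewrite psi_norm ?mulr_ge0 ?(ltW l_gt0)//.
  exact: resolvent_positive.
lra.
Qed.

End Iterates.

(** [Xi l] is [defect] composed with the resolvent. As [defect] does not depend on [l], it can be
    applied to the resolvent identity. *)
Let defect u : R := a0 u - abar u.

Let defect_linear a u v : opdom G u -> opdom G v ->
  defect (a *: u + v) = a * defect u + defect v.
Proof.
move=> u_dom v_dom; rewrite /defect (proj1 abar_def)// /Defs.a0.
have [_ ->] := generator_linear V_sub a u_dom v_dom.
by rewrite psi_linear -[_ *: _]/(a * abar u); ring.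
Qed.

Lemma Xi_linear l a u v : 0 < l ->
  phi l (a *: u + v) = a * phi l u + phi l v.
Proof.
move=> l_gt0; rewrite /Xi resolvent_linear//.
have [u_dom _] := resolventP V_sub u l_gt0.
have [v_dom _] := resolventP V_sub v l_gt0.
exact: defect_linear.
Qed.

Lemma Xi_resolvent l m u : 0 < l -> 0 < m ->
  phi l u = phi m u + (m - l) * phi m (RG l u).
Proof.
move=> l_gt0 m_gt0; rewrite -[phi l u]/(defect (RG l u)).
rewrite {1}(resolvent_identity V_sub u l_gt0 m_gt0) addrC [RHS]addrC.
by apply: defect_linear; exact: (proj1 (resolventP V_sub _ m_gt0)).
Qed.

(** For [m > l], [Xi_resolvent] writes [0] as a sum of two nonnegative terms, so [phi m u = 0];
    exchanging [l] and [m] yields [phi l (RG m u) = 0]. Then [m] decreases to [l]. *)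
Lemma Xi_resolvent_null l u : 0 < l -> K u -> phi l u = 0 -> phi l (RG l u) = 0.
Proof.
move=> l_gt0 Ku u0.
have null m : l < m -> phi l (RG m u) = 0.
  move=> lm; have m_gt0 := lt_trans l_gt0 lm.
  have := Xi_resolvent u l_gt0 m_gt0; have := Xi_resolvent u m_gt0 l_gt0.
  have := Xi_ge0 m_gt0 Ku.
  have := Xi_ge0 m_gt0 (resolvent_positive V_sub l_gt0 Ku).
  rewrite u0; move: (phi m (RG l u)) (phi m u) (phi l (RG m u)).
  move=> a b c a0 b0 e1 e2.
  have a00 : 0 <= (m - l) * a by rewrite mulr_ge0// subr_ge0 ltW.
  have /eqP : (m - l) * c = 0 by lra.
  by rewrite mulf_eq0 subr_eq0 gt_eqF//= => /eqP.
have Kr := resolvent_positive V_sub l_gt0 Ku.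
apply/eqP; rewrite eq_le Xi_ge0// andbT; apply/ler_addgt0Pr => e e_gt0.
have q_gt0 : 0 < l ^+ 2 / (`|u| + 1) by rewrite divr_gt0 ?exprn_gt0// ltr_wpDl.
(* The error is at most [(m - l) |u| / l^2], which this choice turns into [e |u| / (|u| + 1)]. *)
pose m := l + e * (l ^+ 2 / (`|u| + 1)).
have lm : l < m by rewrite ltrDl mulr_gt0.
have m_gt0 := lt_trans l_gt0 lm.
rewrite (resolvent_identity V_sub u l_gt0 m_gt0) addrC Xi_linear// null//.
rewrite addr0 add0r.
have KRR := resolvent_positive V_sub m_gt0 Kr.
have ml : 0 <= m - l by rewrite subr_ge0 ltW.
apply: (le_trans (ler_wpM2l ml (Xi_le l_gt0 KRR))).
have n1 := resolvent_norm V_sub (RG l u) m_gt0.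
have n2 := resolvent_norm V_sub u l_gt0.
have n3 : l ^+ 2 * `|RG m (RG l u)| <= `|u|.
  apply: le_trans n2; rewrite expr2 -mulrA ler_wpM2l ?(ltW l_gt0)//.
  by apply: le_trans n1; rewrite ler_wpM2r// ltW.
have -> : m - l = e * (l ^+ 2 / (`|u| + 1)) by rewrite /m addrC addKr.
rewrite -mulrA ger_pMr// mulrAC ler_pdivrMr ?mul1r; last by rewrite ltr_wpDl.
by rewrite (le_trans n3)// lerDl.
Qed.

Lemma Xi_null_indep l m u : 0 < l -> 0 < m -> K u ->
  phi l u = 0 -> phi m u = 0.
Proof.
move=> l_gt0 m_gt0 Ku u0.
have [lm|ml] := leP l m.
  have := Xi_resolvent u l_gt0 m_gt0; have := Xi_ge0 m_gt0 Ku.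
  have := Xi_ge0 m_gt0 (resolvent_positive V_sub l_gt0 Ku).
  rewrite u0 => a0 b0.
  have := mulr_ge0 (_ : 0 <= m - l) a0; rewrite subr_ge0 lm => /(_ isT); lra.
rewrite (Xi_resolvent u m_gt0 l_gt0) u0 add0r.
suff -> : phi l (RG m u) = 0 by rewrite mulr0.
pose Rn n w := iter n (RG l) w.
have RnS n w : Rn n (RG l w) = Rn n.+1 w by rewrite /Rn iterSr.
have KRn n w : K w -> K (Rn n w).
  by move=> Kw; elim: n => //= n; exact: resolvent_positive.
have Rn_null n : phi l (Rn n u) = 0.
  by elim: n => //= n IHn; apply: Xi_resolvent_null => //; exact: KRn.
have RnD n a w w' : Rn n (a *: w + w') = a *: Rn n w + Rn n w'.
  by elim: n => //= n ->; exact: resolvent_linear.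
(* Each use of the resolvent identity splits off a power of [RG l] at [u], where [phi l]
   vanishes. *)
have iterate n : phi l (RG m u) = (l - m) ^+ n * phi l (Rn n (RG m u)).
  elim: n => [|n IHn]; first by rewrite expr0 mul1r.
  rewrite IHn {1}(resolvent_identity V_sub u m_gt0 l_gt0) [RG l u + _]addrC.
  rewrite RnD Xi_linear//.
  by rewrite !RnS Rn_null addr0 exprSr mulrA.
have KRm := resolvent_positive V_sub m_gt0 Ku.
have Rn_norm n w : l ^+ n * `|Rn n w| <= `|w|.
  elim: n w => [|n IHn] w; first by rewrite expr0 mul1r.
  rewrite /Rn iterSr exprSr -mulrA mulrCA.
  rewrite (le_trans (ler_wpM2l (ltW l_gt0) (IHn _)))//.
  exact: resolvent_norm.
(* Ratio of the geometric decay: [(l - m)^n] against the bound [l^-n] for [Rn n]. *)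
pose q := (l - m) / l.
have q0 : 0 <= q by rewrite divr_ge0 ?subr_ge0 ?(ltW ml) ?(ltW l_gt0).
have q1 : `|q| < 1 by rewrite ger0_norm// ltr_pdivrMr// mul1r gtrBl.
have c : `|RG m u| * q ^+ n @[n --> \oo] --> (0 : R).
  by rewrite -(mulr0 `|RG m u|); apply: cvgMr; exact: cvg_expr.
apply/eqP; rewrite eq_le Xi_ge0// andbT; apply: (cvgr_to_ge c).
apply: nearW => n; rewrite (iterate n) /q expr_div_n mulrCA.
rewrite ler_wpM2l ?exprn_ge0 ?subr_ge0 ?(ltW ml)//.
apply: (le_trans (Xi_le l_gt0 (KRn n _ KRm))).
by rewrite ler_pdivlMr ?exprn_gt0// mulrC.
Qed.

End Perturbation.
End Semigroup.

(** * The null cone of a positive functional [Trace (beta .)] *)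

Section NullCone.
Variables (R : realType) (h : completeNormedModType R[i]).
Variable ip : {dot h for Num.Def.conjC}.
Hypothesis h_hilbert : hilbert_ip ip.
Variables (X : completeNormedModType R) (op : X -> h -> h).
Hypothesis X_space : is_selfadjoint_trace_class_space ip op.
Local Notation K := (positive_cone ip op).

Lemma positive_cone_state_space : state_space K.
Proof.
split.
- exact: (closed_cone h_hilbert X_space).
- exact: (cone0 X_space).
- by move=> u v; exact: (coneD X_space).
- by move=> a u; exact: (coneZ X_space).
- move=> u.
  have [u1 [u2 [Ku1 Ku2 uE uN _]]] := cone_decomposition h_hilbert X_space u.
  by exists u1, u2.
Qed.

Variables (phi : X -> R) (beta : h -> h).
Hypothesis phi_linear : forall a u v, phi (a *: u + v) = a * phi u + phi v.
Hypothesis phi_ge0 : forall u, K u -> 0 <= phi u.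
Hypotheses (beta_bd : bounded_op beta) (beta_sa : selfadjoint ip beta).
Hypothesis beta_psd : psd ip beta.
Hypothesis phi_trace :
  forall u, K u -> (phi u)%:C%C = trace ip (beta \o op u).

(* The functional vanishes on the rank one operators dominated by [u]. *)
Lemma phi_null_range u x : K u -> phi u = 0 -> beta (op u x) = 0.
Proof.
move=> Ku u0; set y := op u x.
have [v vE] := op_rank1 h_hilbert X_space y.
have Kv : K v by rewrite /positive_cone /= vE; exact: psd_rank1.
have v0 : phi v = 0.
  have := phi_ge0 (cone_sub_rank1 X_space Ku vE).
  rewrite addrC -scaleN1r phi_linear -[_ *: u]addr0 phi_linear u0 mulr0 add0r.
  have := phi_linear 1 0 0; rewrite scaler0 addr0 mul1r.
  have := phi_ge0 Kv; lra.
have yy : rip ip (beta y) y = 0.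
  have [beta_lin _] := beta_bd.
  have := phi_trace Kv; rewrite vE v0 trace_rank1//.
    by rewrite /rip => <-.
  exact: (basis_of_spaceP X_space).
have [C C_gt0 betaC] := psd_sqr_bound h_hilbert beta_bd beta_sa beta_psd.
apply: (@rip_eq0 _ _ ip); apply/eqP; rewrite eq_le rip_ge0 andbT.
by rewrite (le_trans (betaC y))// yy mulr0.
Qed.

Lemma range_null_phi u : K u -> (forall x, beta (op u x) = 0) -> phi u = 0.
Proof.
move=> Ku u0; apply: complexI; rewrite phi_trace//.
by rewrite (_ : beta \o op u = fun=> 0) ?trace0//; apply/funext.
Qed.

Variable P : h -> h.
Hypothesis P_proj : orthogonal_projection ip P (null_space beta).

Lemma projection_null y : beta y = 0 <-> P y = y.
Proof.
have [_ PP _ P_range] := P_proj; split=> [y0|<-].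
  have : null_space beta y by [].
  by rewrite -P_range => -[x _ <-]; rewrite -[P (P x)]/((P \o P) x) PP.
by have : range P (P y) by [exists y]; rewrite P_range.
Qed.

(** Each equation is the adjoint of the other. *)
Lemma op_commute_adjoint u : op u = P \o op u <-> op u = op u \o P.
Proof.
have [_ _ P_sa _] := P_proj.
split=> uP; apply/funext => x; apply: (@ip_ext _ _ ip) => z /=.
  rewrite !(op_selfadjoint X_space) P_sa.
  by rewrite {1}uP.
rewrite P_sa !(op_selfadjoint X_space).
by rewrite {1}uP.
Qed.

Lemma phi_nullP u : K u -> phi u = 0 <-> op u = P \o op u.
Proof.
move=> Ku; split=> [u0|uP].
  apply/funext => x /=; apply/esym/projection_null.
  exact: phi_null_range.
apply: range_null_phi => // x; apply/projection_null.
by rewrite {2}uP.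
Qed.

End NullCone.

(** * The span of the null cone *)

Theorem corollary3p23 (R : realType)
    (h : completeNormedModType R[i]) (ip : {dot h for Num.Def.conjC})
    (h_hilbert : hilbert_ip ip) (h_separable : separable h)
    (X : completeNormedModType R) (op : X -> h -> h)
    (X_space : is_selfadjoint_trace_class_space ip op)
    (U : R -> X -> X)
    (U_substochastic : substochastic (positive_cone ip op) U)
    (B : X -> X)
    (B_linear : linear_on (opdom (generator U)) B)
    (B_positive : positive_op (positive_cone ip op) (opdom (generator U)) B)
    (AB_trace : forall u : X, opdom (generator U) u -> positive_cone ip op u ->
       Psi ip op (generator U u + B u) <= 0)
    (V : R -> X -> X)
    (V_minimal : minimal_semigroup (positive_cone ip op) (generator U) B V)
    (abar : X -> R)
    (abar_def : is_abar (Psi ip op) (generator U) B (generator V) abar)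
    (beta : R -> h -> h)
    (beta_def : forall lambda : R, 0 < lambda ->
       [/\ bounded_op (beta lambda), selfadjoint ip (beta lambda),
           psd ip (beta lambda)
         & forall u : X, positive_cone ip op u ->
             (Xi (Psi ip op) (generator V) abar lambda u)%:C%C
             = trace ip (beta lambda \o op u)])
    (lambda : R) (lambda_gt0 : 0 < lambda)
    (P : h -> h)
    (P_proj : orthogonal_projection ip P (null_space (beta lambda))) :
  let H := Xi_null_cone (positive_cone ip op) (Psi ip op) (generator V) abar in
  [set u - v | u in H & v in H]
  = [set u : X | op u = P \o op u /\ op u = op u \o P].
Proof.
move=> H; have K_space := positive_cone_state_space h_hilbert X_space.
have [V_sub G_sum _] := V_minimal.
have psi_lin := Psi_linear h_hilbert X_space.
have psi_norm := Psi_norm h_hilbert X_space.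
have [beta_bd beta_sa beta_psd phi_trace] := beta_def lambda lambda_gt0.
have phi_lin a u v : Xi (Psi ip op) (generator V) abar lambda (a *: u + v) =
    a * Xi (Psi ip op) (generator V) abar lambda u +
    Xi (Psi ip op) (generator V) abar lambda v.
  exact: (Xi_linear K_space psi_lin V_sub abar_def).
have phi_ge0 u : positive_cone ip op u ->
    0 <= Xi (Psi ip op) (generator V) abar lambda u.
  move=> Ku.
  exact: (Xi_ge0 K_space psi_lin psi_norm U_substochastic V_sub B_positive
    G_sum abar_def lambda_gt0 Ku).
have nullP := phi_nullP h_hilbert X_space phi_lin phi_ge0 beta_bd beta_sa
  beta_psd phi_trace P_proj.
have opP := op_commute_adjoint X_space P_proj.
(* [Xi_null_indep] reduces the condition for all parameters to the given [lambda]. *)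
have HP u : H u <-> positive_cone ip op u /\ op u = P \o op u.
  split=> [[Ku u0]|[Ku /(nullP _ Ku) u0]]; split=> //.
    by apply/(nullP _ Ku); exact: u0.
  move=> m m_gt0.
  exact: (Xi_null_indep K_space psi_lin psi_norm U_substochastic V_sub
    B_positive AB_trace G_sum abar_def lambda_gt0 m_gt0 Ku u0).
apply/seteqP; split=> [_ [u /HP[Ku uP] [v /HP[Kv vP] <-]]|u [uP uP']].
  suff uvP : op (u - v) = P \o op (u - v) by split=> //; exact/opP.
  have [[P_lin _] _ _ _] := P_proj.
  apply/funext => x; rewrite /= !(opD X_space, opN X_space).
  rewrite [in LHS]uP [in LHS]vP /=.
  by rewrite -scaleN1r addrC -[in RHS]scaleN1r [in RHS]addrC P_lin.
have [u1 [u2 [Ku1 Ku2 uE _ u_null]]] := cone_decomposition h_hilbert X_space u.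
have op_lin v : {morph op v : x y / x - y}.
  move=> x y; have [v_lin _] := op_bounded X_space v.
  by rewrite addrC -scaleN1r v_lin scaleN1r addrC.
(* [u] vanishes on the range of [1 - P], hence so do its positive and negative parts. *)
have u12 x : op u1 x = op u1 (P x) /\ op u2 x = op u2 (P x).
  have [|] := u_null (x - P x).
    by rewrite op_lin {1}uP' subrr.
  rewrite !op_lin => /eqP; rewrite subr_eq0 => /eqP ->.
  by move=> /eqP; rewrite subr_eq0 => /eqP.
exists u1; last exists u2 => //.
- by apply/HP; split=> //; apply/opP/funext => x; case: (u12 x).
- by apply/HP; split=> //; apply/opP/funext => x; case: (u12 x).
Qed.
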